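(* Let $L_{Q,U}$ be a regular Dirac operator with $q_4=-q_1$. For every $Q\in L_1$ (i.e. all $q_j\in L_1[0,\pi]$) the numbers $s_n:=s_n(r_n)$ satisfy $s_n\to0$ as $n\to\pm\infty$. If, moreover, $Q\in L_p$ (i.e. all $q_j\in L_p[0,\pi]$) with $p\in(1,2]$, then $\{s_n\}_{|n|\ge N}\in l_{p'}$, where $1/p+1/p'=1$.
   Context: **Operator.** $\mathbb H=L_2[0,\pi]\oplus L_2[0,\pi]$; $B=\begin{pmatrix}0&1\\ -1&0\end{pmatrix}$; $Q=\begin{pmatrix}q_1&q_2\\ q_3&q_4\end{pmatrix}$ with complex-valued $q_j\in L_1[0,\pi]$, $q_4=-q_1$; $l_Q(\mathbf y)=-B\mathbf y'+Q\mathbf y$. Boundary form: $U(\mathbf y)=A\mathbf y(0)+D\mathbf y(\pi)$, $A=\begin{pmatrix}u_{11}&u_{12}\\ u_{21}&u_{22}\end{pmatrix}$, $D=\begin{pmatrix}u_{13}&u_{14}\\ u_{23}&u_{24}\end{pmatrix}$ complex; $J_{sj}$ is the determinant formed by the $s$-th and $j$-th columns of the $2\times4$ matrix $(u_{kl})$. $L_{Q,U}$ acts by $l_Q$ on the domain $\{\mathbf y\in AC([0,\pi];\mathbb C^2): l_Q(\mathbf y)\in\mathbb H,\ U(\mathbf y)=0\}$. $U$ and $L_{Q,U}$ are *regular* if both numbers $J_{14}+J_{32}\pm i(J_{42}-J_{13})$ are nonzero. **Strong regularity.** $L_{0,U}$ (zero potential) is *strongly regular* if it is regular and the roots $z_0,z_1$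 of $[J_{14}-J_{23}-i(J_{13}+J_{24})]z^2+2[J_{12}+J_{34}]z+[J_{14}-J_{23}+i(J_{13}+J_{24})]=0$ are distinct. Put $E(x)=\exp\{\frac12\int_0^x(q_2(t)-q_3(t))\,dt\}$, $E=E(\pi)$, $U'(\mathbf y)=A\mathbf y(0)+E\,D\mathbf y(\pi)$. $L_{Q,U}$ is *strongly regular* if $L_{0,U'}$ is. Let now $z_0,z_1$ be the roots of this quadratic equation written for $U'$. The eigenvalues of $L_{0,U'}$ are $\lambda^0_{2m}=-\frac i\pi\ln z_0+2m$, $\lambda^0_{2m+1}=-\frac i\pi\ln z_1+2m$, $m\in\mathbb Z$ (branch $\operatorname{Im}\ln z\in(-\pi,\pi]$). **Functions $\Upsilon$.** $\upsilon_1(x,\lambda)=\int_0^xq_1(t)\sin(2\lambda t)dt$, $\upsilon_2(x,\lambda)=\int_0^xq_1(t)\cos(2\lambda t)dt$, $\upsilon_3(x,\lambda)=\frac12\int_0^x(q_2+q_3)(t)\sin(2\lambda t)dt$, $\upsilon_4(x,\lambda)=\frac12\int_0^x(q_2+q_3)(t)\cos(2\lambda t)dt$; $\Upsilon(x,\lambda)=\sum_{j=1}^4|\upsilon_j(x,\lambda)|$, $\Upsilon_\nu(\lambda)=\sum_{j=1}^4\|\upsilon_j(\cdot,\lambda)\|_{L_\nu[0,\pi]}$, $\Upsilon(\lambda)=\Upsilon_\infty(\lambda)$. The quantities below are formed with an exponent $p\in[1,2]$ such that $Q\in L_p$ ($p=1$ in the first assertion, the given $p$ in the second), $1/p+1/p'=1$,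 $p'=\infty$ if $p=1$. **Numbers $s_n(r)$, $r_n$, $N$.** Choose $\varepsilon>0$ so that closed discs of radius $\varepsilon$ around distinct points $\lambda_n^0$ are disjoint, and $\alpha>0$ so that these discs lie in $\Pi_\alpha=\{|\operatorname{Im}\lambda|<\alpha\}$. Put $s_n(r)=\max_{|\lambda-\lambda_n^0|\le r}(\Upsilon(\pi,\lambda)+\Upsilon_{p'}(\lambda))$, $0\le r\le\varepsilon$. Let $\mathbf c(x,\lambda),\mathbf s(x,\lambda)$ be the solutions of $l_Q(\mathbf y)=\lambda\mathbf y$ with $\mathbf c(0,\lambda)=(1,0)^t$, $\mathbf s(0,\lambda)=(0,1)^t$, $\Delta(\lambda)=\det(A+DV(\lambda))$ with $V(\lambda)$ having columns $\mathbf c(\pi,\lambda),\mathbf s(\pi,\lambda)$, $\Delta^0(\lambda)=\det(A+EDV_0(\lambda))$, $V_0(\lambda)=\begin{pmatrix}\cos\pi\lambda&\sin\pi\lambda\\ -\sin\pi\lambda&\cos\pi\lambda\end{pmatrix}$. With $R=\|Q\|_{L_1}$, $k=2+12R\cosh(2\pi\alpha+1)$, let $M>0$ be a constant such that $|\Delta(\lambda)-\Delta^0(\lambda)|\le M(\Upsilon(\pi,\lambda)+\Upsilon_{p'}(\lambda))$ for $\lambda\in\Pi_\alpha$ with $\Upsilon(\lambda)<1/(8k^4)$. In the strongly regular case let $c_1>0$ be independent of $n$ with $|\Delta^0(\lambda)|\ge c_1|\lambda-\lambda_n^0|$ for $|\lambda-\lambda_n^0|\le\varepsilon$; otherwise let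 $c_2>0$ be independent of $n$ with $|\Delta^0(\lambda)|\ge c_2|\lambda-\lambda_n^0|^2$ there. $N$ is so large that for $|n|\ge N$ one has $\Upsilon(\lambda)<1/(8k^4)$ on $|\lambda-\lambda_n^0|\le\varepsilon$ and $s_n(\varepsilon)\le c_1\varepsilon/M$ (respectively $s_n(\varepsilon)\le c_2\varepsilon^2/M$). For $|n|\ge N$, $r_n\in[0,\varepsilon]$ is the smallest root of $s_n(r)=c_1r/M$ in the strongly regular case and of $s_n(r)=c_2r^2/M$ otherwise. *)

(* Defs.v *)
From HB Require Import structures.
From mathcomp Require Import all_boot all_order all_algebra.
From mathcomp Require Import all_classical all_reals all_analysis.
From mathcomp Require Import complex.

Set Implicit Arguments.
Unset Strict Implicit.
Unset Printing Implicit Defensive.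

Import Order.TTheory GRing.Theory Num.Theory.
Import numFieldNormedType.Exports.
Import ComplexField.Normc.

Local Open Scope classical_set_scope.
Local Open Scope ring_scope.
Local Open Scope complex_scope.

Local Notation Re := complex.Re.
Local Notation Im := complex.Im.

Section ComplexFunctions.
Variable R : realType.
Local Notation C := R[i].
Implicit Types (z : C) (x : R) (f : R -> C).

(* Fixes i concretely: the notation 'i would denote Num.imaginary here. *)
Definition ci : C := 0 +i* 1.

Definition cexp z : C := (expR (Re z))%:C * (cos (Im z) +i* sin (Im z)).

Definition csin z : C := (cexp (ci * z) - cexp (- (ci * z))) / (2%:R * ci).

Definition ccos z : C := (cexp (ci * z) + cexp (- (ci * z))) / 2%:R.

Definition cosh x : R := (expR x + expR (- x)) / 2%:R.

(* Principal branch, Im (cln z) \in ]-pi, pi], for z != 0. *)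
Definition carg z : R :=
  if 0 <= Im z then acos (Re z / normc z) else - acos (Re z / normc z).

Definition cln z : C := ln (normc z) +i* carg z.

Definition cint x f : C :=
  (\int[@lebesgue_measure R]_(t in `[0, x]) Re (f t))
    +i* (\int[@lebesgue_measure R]_(t in `[0, x]) Im (f t)).

(* Functions on [0, pi] are represented by functions on R whose values outside
   [0, pi] are irrelevant; hence the restriction (extension by 0). *)
Definition norm0pi (nu : \bar R) f : \bar R :=
  Lnorm (@lebesgue_measure R) nu ((fun t => (normc (f t))%:E) \_ `[0, pi]).

Definition Lspace0pi (p : R) f : Prop :=
  [/\ measurable_fun `[0, pi] (fun t => Re (f t)),
      measurable_fun `[0, pi] (fun t => Im (f t)) &
      (norm0pi p%:E f < +oo)%E].

Definition abs_continuous0pi f : Prop :=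
  forall e : R, 0 < e -> exists2 d : R, 0 < d &
    forall (n : nat) (a b : 'I_n -> R),
      (forall i, 0 <= a i /\ a i <= b i /\ b i <= pi) ->
      (forall i j, i != j -> b i <= a j \/ b j <= a i) ->
      \sum_(i < n) (b i - a i) < d ->
      \sum_(i < n) normc (f (b i) - f (a i)) < e.

Definition cderiv f x : C :=
  derive1 (fun t => Re (f t)) x +i* derive1 (fun t => Im (f t)) x.

End ComplexFunctions.

Section Dirac.
Variable R : realType.
Local Notation C := R[i].
Local Notation mu := (@lebesgue_measure R).
Implicit Types (Q : R -> 'M[C]_2) (A D : 'M[C]_2) (z lambda : C) (x p : R).

Definition q1 Q t : C := Q t 0 0.
Definition q2 Q t : C := Q t 0 1.
Definition q3 Q t : C := Q t 1 0.
Definition q4 Q t : C := Q t 1 1.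

Definition potential_Lp p Q : Prop := forall i j, Lspace0pi p (fun t => Q t i j).

Definition trace_free Q : Prop :=
  {ae mu, forall t, t \in `[0, pi]%R -> q4 Q t = - q1 Q t}.

Definition Bmx : 'M[C]_2 :=
  \matrix_(i < 2, j < 2)
    (if (i == 0) && (j == 1) then 1 else if (i == 1) && (j == 0) then -1 else 0).

Definition dirac_expr Q (y : R -> 'cV[C]_2) (x : R) : 'cV[C]_2 :=
  - (Bmx *m \col_i cderiv (fun t => y t i 0) x) + Q x *m y x.

Definition dirac_solution Q lambda (y0 : 'cV[C]_2) (y : R -> 'cV[C]_2) : Prop :=
  [/\ forall i, abs_continuous0pi (fun t => y t i 0),
      {ae mu, forall x, x \in `[0, pi]%R -> dirac_expr Q y x = lambda *: y x} &
      y 0 = y0].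

(* Determinant of the columns s and j (numbered from 1) of the 2 x 4 matrix
   (A | D) of the boundary form U(y) = A y(0) + D y(pi). *)
Definition J A D (s j : nat) : C :=
  \det (\matrix_(i < 2, k < 2)
    row_mx A D i (inord (if k == 0 then s else j).-1 : 'I_4)).

Definition regular A D : Prop :=
  J A D 1 4 + J A D 3 2 + ci R * (J A D 4 2 - J A D 1 3) != 0 /\
  J A D 1 4 + J A D 3 2 - ci R * (J A D 4 2 - J A D 1 3) != 0.

Definition char_poly0 A D : {poly C} :=
  (J A D 1 4 - J A D 2 3 - ci R * (J A D 1 3 + J A D 2 4)) *: 'X^2
  + (2%:R * (J A D 1 2 + J A D 3 4)) *: 'X
  + (J A D 1 4 - J A D 2 3 + ci R * (J A D 1 3 + J A D 2 4))%:P.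

(* z0 and z1 are the two roots, counted with multiplicity. *)
Definition char_roots A D z0 z1 : Prop :=
  char_poly0 A D =
    lead_coef (char_poly0 A D) *: (('X - z0%:P) * ('X - z1%:P)).

Definition strongly_regular0 A D : Prop :=
  regular A D /\ exists z0 z1, char_roots A D z0 z1 /\ z0 != z1.

Definition Efun Q x : C :=
  cexp (2%:R^-1 * cint x (fun t => q2 Q t - q3 Q t)).

Definition Econst Q : C := Efun Q pi.

(* U'(y) = A y(0) + E D y(pi) *)
Definition strongly_regular Q A D : Prop :=
  strongly_regular0 A (Econst Q *: D).

(* eig0 z0 z1 n is \lambda^0_n, where z0, z1 are the roots for U'. *)
Definition eig0 z0 z1 (n : int) : C :=
  - (ci R / pi%:C) * cln (if (n %% 2)%Z == 0 then z0 else z1)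
  + (2 * (n %/ 2)%Z)%:~R.

Definition upsilon Q (j : 'I_4) x lambda : C :=
  match val j with
  | 0%N => cint x (fun t => q1 Q t * csin (2%:R * lambda * t%:C))
  | 1%N => cint x (fun t => q1 Q t * ccos (2%:R * lambda * t%:C))
  | 2%N => 2%:R^-1 *
      cint x (fun t => (q2 Q t + q3 Q t) * csin (2%:R * lambda * t%:C))
  | _ => 2%:R^-1 *
      cint x (fun t => (q2 Q t + q3 Q t) * ccos (2%:R * lambda * t%:C))
  end.

Definition Upsilon Q x lambda : R := \sum_j normc (upsilon Q j x lambda).

(* [fine] loses nothing: for Q in L_1 the functions upsilon are continuous in x,
   so that the norms are finite. *)
Definition Upsilon_norm Q (nu : \bar R) lambda : R :=
  \sum_j fine (norm0pi nu (fun x => upsilon Q j x lambda)).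

Definition Upsilon_sup Q lambda : R := Upsilon_norm Q +oo%E lambda.

(* The maximum of a function continuous in lambda over a compact disc,
   written as a supremum. *)
Definition smax Q (p' : \bar R) z0 z1 (n : int) (r : R) : R :=
  sup [set Upsilon Q pi lambda + Upsilon_norm Q p' lambda
      | lambda in [set lambda : C | normc (lambda - eig0 z0 z1 n) <= r]].

Definition normL1 Q : R :=
  \sum_(i < 2) \sum_(j < 2) fine (norm0pi 1 (fun t => Q t i j)).

Definition kconst Q (alpha : R) : R :=
  2%:R + 12%:R * normL1 Q * cosh (2%:R * pi * alpha + 1).

Definition fundamental Q (yc ys : C -> R -> 'cV[C]_2) : Prop :=
  forall lambda,
    dirac_solution Q lambda (delta_mx 0 0) (yc lambda) /\
    dirac_solution Q lambda (delta_mx 1 0) (ys lambda).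

Definition Delta A D (yc ys : C -> R -> 'cV[C]_2) lambda : C :=
  \det (A + D *m (row_mx (yc lambda pi) (ys lambda pi) : 'M[C]_2)).

Definition V0 lambda : 'M[C]_2 :=
  \matrix_(i < 2, j < 2)
    (if i == j then ccos (pi%:C * lambda)
     else if i == 0 then csin (pi%:C * lambda)
     else - csin (pi%:C * lambda)).

Definition Delta0 Q A D lambda : C :=
  \det (A + Econst Q *: (D *m V0 lambda)).

(* 1 in the strongly regular case, 2 otherwise *)
Definition sr_order Q A D : nat := if `[< strongly_regular Q A D >] then 1 else 2.

(* Admissible choices of the auxiliary quantities, formed with the exponent p';
   c stands for c_1 in the strongly regular case and for c_2 otherwise. *)
Record admissible Q A D (p' : \bar R) (z0 z1 : C) (eps alpha : R)
    (yc ys : C -> R -> 'cV[C]_2) (M c : R) (N : nat) (r : int -> R) : Prop := {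
  adm_roots : char_roots A (Econst Q *: D) z0 z1;
  adm_eps : 0 < eps;
  adm_disjoint : forall m n : int, eig0 z0 z1 m != eig0 z0 z1 n ->
    forall lambda, ~ (normc (lambda - eig0 z0 z1 m) <= eps /\
                      normc (lambda - eig0 z0 z1 n) <= eps);
  adm_alpha : 0 < alpha;
  adm_strip : forall (n : int) lambda,
    normc (lambda - eig0 z0 z1 n) <= eps -> `|Im lambda| < alpha;
  adm_fundamental : fundamental Q yc ys;
  adm_M : 0 < M;
  adm_Delta : forall lambda, `|Im lambda| < alpha ->
    Upsilon_sup Q lambda < 1 / (8%:R * kconst Q alpha ^+ 4) ->
    normc (Delta A D yc ys lambda - Delta0 Q A D lambda)
      <= M * (Upsilon Q pi lambda + Upsilon_norm Q p' lambda);
  adm_c : 0 < c;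
  adm_Delta0 : forall (n : int) lambda, normc (lambda - eig0 z0 z1 n) <= eps ->
    c * normc (lambda - eig0 z0 z1 n) ^+ sr_order Q A D
      <= normc (Delta0 Q A D lambda);
  adm_N_Upsilon : forall n : int, (N <= `|n|)%N -> forall lambda,
    normc (lambda - eig0 z0 z1 n) <= eps ->
    Upsilon_sup Q lambda < 1 / (8%:R * kconst Q alpha ^+ 4);
  adm_N_s : forall n : int, (N <= `|n|)%N ->
    smax Q p' z0 z1 n eps <= c * eps ^+ sr_order Q A D / M;
  adm_r : forall n : int, (N <= `|n|)%N ->
    [/\ 0 <= r n, r n <= eps,
        smax Q p' z0 z1 n (r n) = c * r n ^+ sr_order Q A D / M &
        forall rho : R, 0 <= rho -> rho <= eps ->
          smax Q p' z0 z1 n rho = c * rho ^+ sr_order Q A D / M -> r n <= rho]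
}.

End Dirac.

(* Main.v *)
(* Only r_n <= eps matters: s_n is at most twice the value of
   Upsilon(pi, .) + Upsilon_p'(.) at some point lambda_n of the disc of radius
   eps around lambda_n^0, and lambda_n = n + O(1).  Hence the numbers
   upsilon_j(x, lambda_n) are combinations of real coefficients
     c_n(f) = int_0^pi f e_n,   e_n(t) = exp(a_n t) cos(b_n t + th_n),
   with a_n bounded and b_n = 2n + O(1), where f is the real or imaginary part
   of q_1 or q_2 + q_3, cut off at x.  The Gram matrix of the e_n for a weight
   vanishing at the ends of [- pi, 2 pi] decays like (1 + (m - n)^2)^-1 +
   (1 + (m + n)^2)^-1, so that the Schur test gives Bessel's inequality
   sum_n c_n(f)^2 <= G int f^2.  For f in L_1, cutting f at a large height gives
   c_n -> 0, uniformly in x because the coefficients of a bounded function are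
   Lipschitz in x.  For f in L_p, interpolation between Bessel's inequality and
   the trivial bound |c_n(f)| <= B int |f| gives the Hausdorff-Young inequality
   sum_n |c_n(f)|^p' <= C with C independent of x, and integrating it in x
   controls the norms in L_p'[0, pi]. *)
Require Import Defs.
From HB Require Import structures.
From mathcomp Require Import all_boot all_order all_algebra.
From mathcomp Require Import all_classical all_reals all_analysis.
From mathcomp Require Import complex.
From mathcomp Require Import measurable_realfun ess_sup_inf ring lra.

Set Implicit Arguments.
Unset Strict Implicit.
Unset Printing Implicit Defensive.

Import Order.TTheory GRing.Theory Num.Theory.
Import numFieldNormedType.Exports.

Local Open Scope classical_set_scope.
Local Open Scope ring_scope.

(** * Real-valued integrands and their integrals *)

Section Integration.
Context d (T : measurableType d) (R : realType).
Variables (mu : {measure set T -> \bar R}) (D : set T).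
Hypothesis mD : measurable D.
Implicit Types f g : T -> R.
Local Notation itg f := (mu.-integrable D (EFin \o f)).

Lemma integrable_EFin_measurable f : itg f -> measurable_fun D f.
Proof. by move=> /(measurable_int mu) /measurable_EFinP. Qed.

Lemma integrable_EFinD f g : itg f -> itg g -> itg (fun x => f x + g x).
Proof. by move=> If Ig; exact: (integrableD mD If Ig). Qed.

Lemma integrable_EFinZ f k : itg f -> itg (fun x => k * f x).
Proof. by move=> If; exact: (integrableZl mD k If). Qed.

Lemma integrable_EFin_sum (I : Type) (s : seq I) (F : I -> T -> R) :
  (forall i, itg (F i)) -> itg (fun x => \sum_(i <- s) F i x).
Proof.
move=> IF; rewrite (_ : EFin \o _ = (fun x => \sum_(i <- s) (F i x)%:E)%E).
  by apply: (integrable_sum mD) => i _; exact: IF.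
by apply/funext => x /=; rewrite sumEFin.
Qed.

Lemma integrable_EFinM_bounded f g (B : R) : itg f -> measurable_fun D g ->
  (forall x, D x -> `|g x| <= B) -> itg (fun x => f x * g x).
Proof.
move=> If mg gB; apply: (integrableMl mD If mg).
exists B; split; [exact: num_real|].
by move=> y By x Dx /=; apply: le_trans (gB _ Dx) (ltW By).
Qed.

Lemma integrable_EFin_le f g : measurable_fun D f ->
  (forall x, D x -> `|f x| <= `|g x|) -> itg g -> itg f.
Proof.
move=> mf fg; apply: le_integrable => //; exact/measurable_EFinP.
Qed.

Lemma Rintegral_sum (I : Type) (s : seq I) (F : I -> T -> R) :
  (forall i, itg (F i)) ->
  \int[mu]_(x in D) (\sum_(i <- s) F i x) = \sum_(i <- s) \int[mu]_(x in D) F i x.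
Proof.
move=> IF; elim: s => [|i s ih].
  rewrite big_nil; under eq_Rintegral do rewrite big_nil.
  by rewrite Rintegral_cst// mul0r.
rewrite big_cons -ih -RintegralD//; last exact: integrable_EFin_sum.
by apply: eq_Rintegral => x _; rewrite big_cons.
Qed.

End Integration.

(** * Schur test *)

Section SumKernel.
Variable R : realType.

Definition skernel (n : int) : R := (1 + n%:~R ^+ 2)^-1.

Lemma skernel_ge0 n : 0 <= skernel n.
Proof. by rewrite invr_ge0 addr_ge0// sqr_ge0. Qed.

Lemma skernelN n : skernel (- n) = skernel n.
Proof. by rewrite /skernel mulrNz sqrrN. Qed.

(** Comparison with the telescoping series of 3 / ((i + 1) (i + 2)), whose partial sums are 3 - 3 /
    (N + 1). *)
Lemma sum_skernel_nat (N : nat) :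
  \sum_(0 <= i < N) skernel i%:Z <= 3.
Proof.
suff : \sum_(0 <= i < N) skernel i%:Z <= 3 - 3 / (N%:R + 1).
  move=> /le_trans; apply; rewrite gerBl divr_ge0// addr_ge0//.
elim: N => [|N ih]; first by rewrite big_nil add0r invr1; lra.
rewrite big_nat_recr//= (le_trans (lerD ih (lexx _)))// /skernel.
rewrite -addrA lerD2l -natr1 -pmulrn.
have N0 : 0 <= N%:R :> R by rewrite ler0n.
(* 3 (1 + N^2) - (N + 1) (N + 2) = (2 N - 1) (N - 1), which is nonnegative at integers though not at
   all reals. *)
have h : 0 <= (2 * N%:R - 1) * (N%:R - 1) :> R.
  case: N {ih N0} => [|N]; first by rewrite mulr0; lra.
  by rewrite -natr1; have := ler0n R N; nra.
have p1 : 0 < N%:R + 1 :> R by lra.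
have p2 : 0 < N%:R + 1 + 1 :> R by lra.
have p3 : 0 < 1 + N%:R ^+ 2 :> R by rewrite ltr_pwDl// sqr_ge0.
rewrite -subr_ge0.
rewrite [X in 0 <= X](_ : _ = ((2 * N%:R - 1) * (N%:R - 1)) /
    ((N%:R + 1) * (N%:R + 1 + 1) * (1 + N%:R ^+ 2))).
  by rewrite divr_ge0// !mulr_ge0// ltW.
by field; rewrite !gt_eqF.
Qed.

Lemma sum_skernel_uniq_nat (s : seq nat) : uniq s ->
  \sum_(i <- s) skernel i%:Z <= 3.
Proof.
move=> us; apply: le_trans (sum_skernel_nat (\max_(i <- s) i).+1).
set N := (\max_(i <- s) i).+1.
have sN : {subset s <= index_iota 0 N}.
  by move=> i si; rewrite mem_index_iota /= ltnS leq_bigmax_seq.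
rewrite (perm_big [seq i <- index_iota 0 N | i \in s]); last first.
  rewrite uniq_perm// ?filter_uniq ?iota_uniq// => i.
  by rewrite mem_filter; case: (boolP (i \in s)) => //= /sN ->.
rewrite big_filter big_mkcond/= ler_sum// => i _; case: ifP => // _.
exact: skernel_ge0.
Qed.

Lemma sum_skernel (s : seq int) : uniq s -> \sum_(n <- s) skernel n <= 6.
Proof.
move=> us; pose pos (n : int) := if n is Posz _ then true else false.
rewrite (bigID pos)/= -big_filter -[X in _ + X]big_filter.
(* The absolute value is injective on the nonnegative and on the negative integers, so each half is
   a sum over distinct naturals. *)
have half (P : pred int) : {in P &, injective absz} ->
    \sum_(n <- seq.filter P s) skernel n <= 3.
  move=> Pinj; rewrite (eq_bigr (fun n : int => skernel `|n|%N)); last first.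
    by move=> [n|n] _ //; rewrite -skernelN NegzE opprK.
  rewrite -(big_map absz xpredT (fun i : nat => skernel i)).
  apply: sum_skernel_uniq_nat; rewrite map_inj_in_uniq ?filter_uniq//.
  by move=> x y; rewrite !mem_filter => /andP[Px _] /andP[Py _]; exact: Pinj.
rewrite (_ : 6 = 3 + 3); last by lra.
by rewrite lerD// half//; case=> m; case=> n //= _ _; [move=> ->|case=> ->].
Qed.

Lemma sum_skernelD (s : seq int) (m : int) : uniq s ->
  \sum_(n <- s) skernel (m + n) <= 6.
Proof.
move=> us; rewrite -(big_map (+%R m) xpredT skernel) sum_skernel//.
by rewrite map_inj_uniq//; exact: addrI.
Qed.

Lemma sum_skernelB (s : seq int) (m : int) : uniq s ->
  \sum_(n <- s) skernel (m - n) <= 6.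
Proof.
move=> us; rewrite (eq_bigr (fun n => skernel (- m + n))) ?sum_skernelD//.
by move=> n _; rewrite -skernelN opprB addrC.
Qed.

(** |x_m| |x_n| <= (x_m^2 + x_n^2) / 2 splits the form into two sums, equal by the symmetry of [k];
    the row sums bound each. *)
Lemma schur_test (s : seq int) (k : int -> int -> R) (x : int -> R) (C : R) :
  (forall m n, 0 <= k m n) -> (forall m n, k m n = k n m) ->
  (forall m, \sum_(n <- s) k m n <= C) ->
  \sum_(m <- s) \sum_(n <- s) `|x m| * `|x n| * k m n
    <= C * \sum_(n <- s) x n ^+ 2.
Proof.
move=> k0 kC kle.
apply: (@le_trans _ _ (\sum_(m <- s) \sum_(n <- s)
  (x m ^+ 2 * k m n / 2 + x n ^+ 2 * k m n / 2))).
  apply: ler_sum => m _; apply: ler_sum => n _.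
  rewrite -(real_normK (num_real (x m))) -(real_normK (num_real (x n))).
  by have := mulr_ge0 (sqr_ge0 (`|x m| - `|x n|)) (k0 m n); lra.
under eq_bigr do rewrite big_split/=.
rewrite big_split/= [X in _ + X]exchange_big/=.
have le2 : \sum_(m <- s) \sum_(n <- s) x m ^+ 2 * k m n / 2 <=
    C * (\sum_(n <- s) x n ^+ 2) / 2.
  rewrite mulr_sumr mulr_suml; apply: ler_sum => m _.
  rewrite -mulr_suml -mulr_sumr ler_wpM2r ?invr_ge0// mulrC.
  by rewrite ler_wpM2r ?sqr_ge0.
rewrite [X in _ + X](eq_bigr (fun m => \sum_(n <- s) x m ^+ 2 * k m n / 2)).
  by rewrite (splitr (C * _)) lerD.
by move=> m _; apply: eq_bigr => n _; rewrite kC.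
Qed.

End SumKernel.

(** * Almost orthogonality of waves *)

Section Waves.
Variable R : realType.
Local Notation mu := (@lebesgue_measure R).
Implicit Types a b th t x : R.

(** The real part of exp((a + i b) t + i th). The phase covers cosine (th = 0) and sine (th = - pi /
    2) at once. *)
Definition wave a b th t := expR (a * t) * cos (b * t + th).

(** Product-to-sum formula: inner products of waves become integrals of single waves at the sum and
    the difference of the frequencies. *)
Lemma waveM a b th a' b' th' t : wave a b th t * wave a' b' th' t =
  (wave (a + a') (b + b') (th + th') t + wave (a + a') (b - b') (th - th') t) / 2.
Proof.
rewrite /wave [(a + a') * t]mulrDl expRD.
rewrite (_ : (b + b') * t + _ = (b * t + th) + (b' * t + th')); last by ring.
rewrite (_ : (b - b') * t + _ = (b * t + th) - (b' * t + th')); last by ring.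
by rewrite (cosD (b * t + th)) (cosB (b * t + th)); field.
Qed.

Lemma ler_norm_wave a b th t al : `|a| <= al -> `|t| <= 2 * pi ->
  `|wave a b th t| <= expR (2 * pi * al).
Proof.
move=> aal tpi; rewrite normrM -[leRHS]mulr1 ler_pM//; last by exact: cos_max.
rewrite gtr0_norm ?expR_gt0// ler_expR (le_trans (ler_norm _))// normrM mulrC.
exact: ler_pM.
Qed.

Lemma derivable_continuous (f : R -> R) :
  (forall t, derivable f t 1) -> continuous f.
Proof. by move=> df t; apply/differentiable_continuous/derivable1_diffP/df. Qed.

Lemma continuous_wave a b th : continuous (wave a b th).
Proof.
apply: derivable_continuous => t.
by rewrite /wave; apply: ex_derive.
Qed.

Lemma measurable_wave a b th A : measurable_fun A (wave a b th).
Proof.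
apply: measurable_funTS; apply: continuous_measurable_fun.
exact: continuous_wave.
Qed.

(* At least 2 pi^2 on [0, pi], and vanishing at both ends of [- pi, 2 pi]: the
   first boundary terms of the integration by parts disappear, which leaves a
   decay of order b^-2 in the frequency b, summable in the Schur test. *)
Definition weight t := (t + pi) * (2 * pi - t).

Lemma weight_continuous : continuous weight.
Proof.
apply: derivable_continuous => t.
by rewrite /weight; apply: ex_derive.
Qed.

Lemma weight_bounds t : - pi <= t <= 2 * pi -> 0 <= weight t <= 9 * pi ^+ 2.
Proof.
by move=> /andP[t1 t2]; have := @pi_ge0 R; rewrite /weight; nra.
Qed.

(** Integration by parts, twice. As [weight] vanishes at both ends, only its slopes there, 3 pi and
    - 3 pi, survive in the boundary terms. One copy of the integral is added on both sides, so that
    the factor is 1 + b^2, nonzero also at b = 0; hence a^2 - 1 instead of a^2. *)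
Lemma integral_weighted_waveE a b th :
  (1 + b ^+ 2) * \int[mu]_(t in `[- pi, 2 * pi]) (weight t * wave a b th t) =
  - 3 * pi * wave a b th (2 * pi) - 3 * pi * wave a b th (- pi)
  - \int[mu]_(t in `[- pi, 2 * pi])
     ((-2 + 2 * a * (pi - 2 * t) + (a ^+ 2 - 1) * weight t) * wave a b th t).
Proof.
pose k t := (1 + b ^+ 2) * (weight t * wave a b th t)
  + (-2 + 2 * a * (pi - 2 * t) + (a ^+ 2 - 1) * weight t) * wave a b th t.
(* [G] gathers the boundary terms of both integrations; pi - 2 t is the derivative of [weight]. *)
pose G t := b * weight t * expR (a * t) * sin (b * t + th)
  + (pi - 2 * t + a * weight t) * wave a b th t.
have dG t : is_derive t 1 G (k t).
  rewrite /G /k /weight /wave; apply: is_derive_eq.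
  by rewrite /GRing.scale /=; ring.
have ck : continuous k.
  apply: derivable_continuous => t; rewrite /k /weight /wave.
  by apply: ex_derive.
have pi0 := @pi_gt0 R.
have ab : - pi < 2 * pi :> R by lra.
have cw : continuous (fun t => weight t * wave a b th t).
  by apply: derivable_continuous => t; rewrite /weight /wave; apply: ex_derive.
have cr : continuous (fun t =>
    (-2 + 2 * a * (pi - 2 * t) + (a ^+ 2 - 1) * weight t) * wave a b th t).
  by apply: derivable_continuous => t; rewrite /weight /wave; apply: ex_derive.
have itg (f : R -> R) : continuous f ->
    mu.-integrable `[- pi, 2 * pi] (EFin \o f).
  move=> cf; apply: continuous_compact_integrable; first exact: segment_compact.
  exact: continuous_subspaceT.
have dG' t : derivable G t 1 by have [] := dG t.
have cG := derivable_continuous dG'.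
have FTC : (\int[mu]_(t in `[(- pi)%R, (2 * pi)%R]) (k t)%:E =
            (G (2 * pi)%R)%:E - (G (- pi)%R)%:E)%E.
  apply: continuous_FTC2 => //.
  - exact: continuous_subspaceT.
  - split; first by move=> t _; exact: dG'.
    + exact/cvg_at_right_filter/cG.
    + exact/cvg_at_left_filter/cG.
  - by move=> t _; rewrite derive1E; apply: derive_val.
have : \int[mu]_(t in `[- pi, 2 * pi]) k t = G (2 * pi) - G (- pi).
  by rewrite /Rintegral FTC.
rewrite /k RintegralD//; [|by apply: integrable_EFinZ => //; exact: itg|exact: itg].
rewrite RintegralZl//; last exact: itg.
move=> /(canRL (addrK _)) ->; congr (_ - _).
by rewrite /G /weight; ring.
Qed.

Lemma Rintegral_bounded (f : R -> R) x y (M : R) : x <= y ->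
  measurable_fun `[x, y] f -> (forall t, x <= t <= y -> `|f t| <= M) ->
  mu.-integrable `[x, y] (EFin \o f) /\
  `|\int[mu]_(t in `[x, y]) f t| <= M * (y - x).
Proof.
move=> xy mf fM.
have bI (g : R -> R) : measurable_fun `[x, y] g ->
    (forall t, x <= t <= y -> `|g t| <= M) -> mu.-integrable `[x, y] (EFin \o g).
  move=> mg gM; apply: measurable_bounded_integrable => //.
    rewrite /= lebesgue_measure_itv/=; case: ifP => // _.
    by rewrite -EFinB ltry.
  exists M; split; first exact: num_real.
  move=> N MN t /=; rewrite in_itv/= => txy.
  exact: le_trans (gM _ txy) (ltW MN).
have If := bI _ mf fM.
split => //; apply: le_trans (le_normr_Rintegral _ If) _ => //.
apply: (@le_trans _ _ (\int[mu]_(t in `[x, y]) cst M t)).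
  apply: le_Rintegral => //; first exact: integrable_norm.
    apply: bI => // t txy; rewrite /= ger0_norm//.
    exact: le_trans (normr_ge0 _) (fM _ txy).
rewrite Rintegral_cst//= lebesgue_measure_itv/= lte_fin.
case: ltP => [_|yx]; first by rewrite -EFinB.
by rewrite (le_anti (_ : x <= y <= x)) ?xy// subrr mulr0.
Qed.

Lemma integral_weighted_wave_le al : 0 <= al -> exists2 C, 0 < C &
  forall a b th, `|a| <= al ->
    `|\int[mu]_(t in `[- pi, 2 * pi]) (weight t * wave a b th t)|
      <= C / (1 + b ^+ 2).
Proof.
move=> al0; have pi0 := @pi_gt0 R.
pose E := expR (2 * pi * al).
have E0 : 0 < E by exact: expR_gt0.
(* Bounds the factor of the wave in the remaining integral, by |pi - 2 t| <= 3 pi and [weight t] <=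
   9 pi^2. *)
pose M := 2 + 2 * al * (3 * pi) + (al ^+ 2 + 1) * (9 * pi ^+ 2).
have M0 : 0 < M.
  rewrite /M -addrA ltr_pwDl// addr_ge0// !mulr_ge0//; try lra.
  by rewrite addr_ge0// sqr_ge0.
(* Two boundary terms of size 3 pi E each, and an integrand of size M E over an interval of length 3
   pi. *)
exists (6 * pi * E + M * E * (3 * pi)).
  by rewrite addr_gt0// !mulr_gt0//; lra.
move=> a b th aal.
rewrite ler_pdivlMr; last by rewrite ltr_pwDl// sqr_ge0.
rewrite -{1}[1 + b ^+ 2]ger0_norm; last by rewrite addr_ge0// sqr_ge0.
rewrite -normrM mulrC integral_weighted_waveE.
have wE t : - pi <= t <= 2 * pi -> `|wave a b th t| <= E.
  by move=> /andP[t1 t2]; apply: ler_norm_wave => //; rewrite ler_norml; lra.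
apply: le_trans (ler_normB _ _) _; apply: lerD.
  apply: le_trans (ler_normB _ _) _.
  rewrite !(normrM _ (wave _ _ _ _)) !(normrM _ pi).
  rewrite !(ger0_norm (ltW pi0)) normrN normr_nat.
  have := wE (2 * pi); have := wE (- pi).
  rewrite lexx (_ : - pi <= 2 * pi) ?lexx//=; last by lra.
  move=> /(_ isT) /(ler_wpM2l (ltW pi0)) h1 /(_ isT) /(ler_wpM2l (ltW pi0)) h2.
  by move: h1 h2; lra.
rewrite (_ : 3 * pi = 2 * pi - - pi); last by ring.
have mk : measurable_fun `[- pi, 2 * pi] (fun t =>
    (-2 + 2 * a * (pi - 2 * t) + (a ^+ 2 - 1) * weight t) * wave a b th t).
  apply: measurable_funTS; apply: continuous_measurable_fun.
  by apply: derivable_continuous => t; rewrite /weight /wave; apply: ex_derive.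
apply: (Rintegral_bounded _ mk _).2; first by lra.
move=> t tI; rewrite normrM ler_pM//; last exact: wE.
have /andP[w0 w9] := weight_bounds tI.
have /andP[t1 t2] := tI.
apply: le_trans (ler_normD _ _) _; apply: lerD.
  apply: le_trans (ler_normD _ _) _; rewrite normrN normr_nat lerD2l.
  rewrite !normrM normr_nat ler_pM ?mulr_ge0//; first by rewrite ler_wpM2l.
  by rewrite ler_norml; lra.
rewrite normrM ler_pM//; last by rewrite ger0_norm.
apply: le_trans (ler_normB _ _) _; rewrite normr1 lerD2r normrX.
by rewrite lerXn2r ?nnegrE.
Qed.

End Waves.

(** * Gram matrices of waves at frequencies near 2 n *)

Section Bessel.
Variable R : realType.
Local Notation mu := (@lebesgue_measure R).

(** |2 n| <= |b| + be bounds 1 + n^2 by a multiple of 1 + b^2: a bounded shift of the frequency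
    costs only a constant factor. *)
Lemma skernel_comparison (be b : R) (n : int) : `|b - 2 * n%:~R| <= be ->
  (1 + b ^+ 2)^-1 <= (2 + 8 * be ^+ 2) * skernel R n.
Proof.
move=> bn.
have p1 : 0 < 1 + b ^+ 2 by rewrite ltr_pwDl// sqr_ge0.
have p2 : 0 < 1 + n%:~R ^+ 2 :> R by rewrite ltr_pwDl// sqr_ge0.
rewrite /skernel ler_pdivlMr// mulrC ler_pdivrMr//.
have h : (b - 2 * n%:~R) ^+ 2 <= be ^+ 2.
  by rewrite -(real_normK (num_real (b - _))) lerXn2r// ?nnegrE// (le_trans _ bn).
have := sqr_ge0 (2 * b - 2 * n%:~R); have := sqr_ge0 b; have := sqr_ge0 be.
have := sqr_ge0 (b * be); nra.
Qed.

(** On [0, pi] the weight is at least 2 pi^2, so the integral of the square is dominated by a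
    weighted one over [- pi, 2 pi]. Expanding the square there leaves inner products to which the
    Schur test applies. *)
Lemma gram_waves (al be : R) : 0 <= al -> 0 <= be -> exists2 G, 0 < G &
  forall (a b th : int -> R), (forall n, `|a n| <= al) ->
    (forall n, `|b n - 2 * n%:~R| <= be) ->
  forall s, uniq s -> forall x : int -> R,
    \int[mu]_(t in `[0, pi]) (\sum_(n <- s) x n * wave (a n) (b n) (th n) t) ^+ 2
      <= G * \sum_(n <- s) x n ^+ 2.
Proof.
move=> al0 be0; have pi0 := @pi_gt0 R.
(* Products of waves have exponents of size up to 2 al, and frequencies within 2 be of 2 (m + n) or
   2 (m - n). *)
have [C C0 HC] := @integral_weighted_wave_le R (2 * al) (mulr_ge0 (ler0n _ 2) al0).
pose c := C * (2 + 8 * (2 * be) ^+ 2) / 2.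
have c0 : 0 < c.
  by rewrite divr_gt0// mulr_gt0// ltr_pwDl// mulr_ge0// sqr_ge0.
(* 12 = 6 + 6 bounds the row sums of the two kernels, in m + n and in m - n; 2 pi^2 is the lower
   bound of the weight on [0, pi]. *)
exists (c * 12 / (2 * pi ^+ 2)).
  by apply: divr_gt0; apply: mulr_gt0 => //; apply: exprn_gt0.
move=> a b th aal bbe s us x.
pose e n := wave (a n) (b n) (th n).
have cont_itg (f : R -> R) (u v : R) : continuous f ->
    mu.-integrable `[u, v] (EFin \o f).
  move=> cf; apply: continuous_compact_integrable; first exact: segment_compact.
  exact: continuous_subspaceT.
have we m n : `|\int[mu]_(t in `[- pi, 2 * pi]) (weight t * (e m t * e n t))|
    <= c * (skernel R (m + n) + skernel R (m - n)).
  have -> : \int[mu]_(t in `[- pi, 2 * pi]) (weight t * (e m t * e n t)) =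
    2^-1 * (\int[mu]_(t in `[- pi, 2 * pi])
       (weight t * wave (a m + a n) (b m + b n) (th m + th n) t) +
     \int[mu]_(t in `[- pi, 2 * pi])
       (weight t * wave (a m + a n) (b m - b n) (th m - th n) t)).
    have cw a' b' th' : continuous (fun t : R => weight t * wave a' b' th' t).
      move=> t; apply: continuousM; first exact: weight_continuous.
      exact: continuous_wave.
    rewrite -RintegralD//; [|exact: cont_itg|exact: cont_itg].
    rewrite -RintegralZl//; last first.
      by apply: integrable_EFinD => //; exact: cont_itg.
    by apply: eq_Rintegral => t _; rewrite waveM; field.
  have aa : `|a m + a n| <= 2 * al.
    by have := lerD (aal m) (aal n); have := ler_normD (a m) (a n); lra.
  rewrite normrM ger0_norm ?invr_ge0//.
  have h1 : `|b m + b n - 2 * (m + n)%:~R| <= 2 * be.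
    rewrite (_ : _ - _ = (b m - 2 * m%:~R) + (b n - 2 * n%:~R)).
      have := lerD (bbe m) (bbe n).
      by have := ler_normD (b m - 2 * m%:~R) (b n - 2 * n%:~R); lra.
    by rewrite intrD; ring.
  have h2 : `|b m - b n - 2 * (m - n)%:~R| <= 2 * be.
    rewrite (_ : _ - 2 * _ = (b m - 2 * m%:~R) - (b n - 2 * n%:~R)).
      have := lerD (bbe m) (bbe n).
      by have := ler_normB (b m - 2 * m%:~R) (b n - 2 * n%:~R); lra.
    by rewrite intrB; ring.
  have g1 := HC _ (b m + b n) (th m + th n) aa.
  have g2 := HC _ (b m - b n) (th m - th n) aa.
  have k1 := skernel_comparison h1; have k2 := skernel_comparison h2.
  rewrite /c.
  have := ler_wpM2l (ltW C0) k1; have := ler_wpM2l (ltW C0) k2.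
  set u := \int[mu]_(_ in _) _ in g1 *; set v := \int[mu]_(_ in _) _ in g2 *.
  by have := ler_normD u v; move: g1 g2; lra.
pose S t := \sum_(n <- s) x n * e n t.
have cS : continuous S.
  rewrite /S; elim: (s) => [|n r ih] t.
    by under eq_fun do rewrite big_nil; exact: cvg_cst.
  under eq_fun do rewrite big_cons.
  apply: cvgD; last exact: ih.
  by apply: cvgM; [exact: cvg_cst|exact: continuous_wave].
have cwS : continuous (fun t => weight t * S t ^+ 2).
  move=> t; apply: continuousM; first exact: weight_continuous.
  by apply: continuousM; exact: cS.
have cSS : continuous (fun t => S t ^+ 2).
  by move=> t; apply: continuousM; exact: cS.
have le1 : 2 * pi ^+ 2 * \int[mu]_(t in `[0, pi]) S t ^+ 2 <=
    \int[mu]_(t in `[- pi, 2 * pi]) (weight t * S t ^+ 2).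
  rewrite -RintegralZl//; last exact: cont_itg.
  apply: (@le_trans _ _ (\int[mu]_(t in `[0, pi]) (weight t * S t ^+ 2))).
    apply: le_Rintegral => //; [|exact: cont_itg|].
      by apply: integrable_EFinZ => //; exact: cont_itg.
    move=> t /=; rewrite in_itv/= => /andP[t0 tpi].
    by rewrite ler_wpM2r ?sqr_ge0// /weight; nra.
  have sub : `[0, pi] `<=` `[- pi, (2 * pi : R)].
    by apply: subset_itv; rewrite bnd_simp; lra.
  apply: fine_le.
  - by apply: integrable_fin_num => //; exact: cont_itg.
  - by apply: integrable_fin_num => //; exact: cont_itg.
  - apply: ge0_subset_integral => //.
      by apply/measurable_EFinP; apply: measurable_funTS; exact: continuous_measurable_fun.
    move=> t /=; rewrite in_itv/= => tI; rewrite lee_fin mulr_ge0 ?sqr_ge0//.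
    by have /andP[] := weight_bounds tI.
have cee m n : continuous (fun t => weight t * (e m t * e n t)).
  move=> t; apply: continuousM; first exact: weight_continuous.
  by apply: continuousM; exact: continuous_wave.
have eq2 : \int[mu]_(t in `[- pi, 2 * pi]) (weight t * S t ^+ 2) =
    \sum_(m <- s) \sum_(n <- s) x m * x n *
      \int[mu]_(t in `[- pi, 2 * pi]) (weight t * (e m t * e n t)).
  have Iee m n : mu.-integrable `[- pi, 2 * pi]
      (EFin \o (fun t => x m * x n * (weight t * (e m t * e n t)))).
    by apply: integrable_EFinZ => //; exact: cont_itg.
  transitivity (\int[mu]_(t in `[- pi, 2 * pi])
      \sum_(m <- s) \sum_(n <- s) x m * x n * (weight t * (e m t * e n t))).
    apply: eq_Rintegral => t _; rewrite /S expr2 big_distrlr/= mulr_sumr.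
    apply: eq_bigr => m _; rewrite mulr_sumr.
    by apply: eq_bigr => n _; ring.
  rewrite Rintegral_sum//; last by move=> m; exact: integrable_EFin_sum.
  apply: eq_bigr => m _; rewrite Rintegral_sum//.
  by apply: eq_bigr => n _; rewrite RintegralZl//; exact: cont_itg.
have le3 : \sum_(m <- s) \sum_(n <- s) x m * x n *
      \int[mu]_(t in `[- pi, 2 * pi]) (weight t * (e m t * e n t)) <=
    \sum_(m <- s) \sum_(n <- s) `|x m| * `|x n| *
      (c * (skernel R (m + n) + skernel R (m - n))).
  apply: ler_sum => m _; apply: ler_sum => n _.
  by rewrite (le_trans (ler_norm _))// !normrM ler_wpM2l// mulr_ge0.
have le4 := @schur_test _ s
  (fun m n => c * (skernel R (m + n) + skernel R (m - n))) x (c * 12).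
rewrite mulrAC ler_pdivlMr ?mulr_gt0 ?exprn_gt0// mulrC.
apply: (le_trans le1); rewrite eq2; apply: (le_trans le3); apply: le4.
- by move=> m n; apply: mulr_ge0; [exact: ltW|apply: addr_ge0; exact: skernel_ge0].
- by move=> m n; rewrite [m + n]addrC -(skernelN _ (m - n)) opprB.
- move=> m; rewrite -mulr_sumr ler_wpM2l// ?(ltW c0)// big_split/=.
  rewrite (_ : 12 = 6 + 6); last by lra.
  by rewrite lerD ?sum_skernelD// sum_skernelB.
Qed.

End Bessel.

(** * Bessel's inequality from a bound on the Gram matrix *)

Section AbstractBessel.
Context d (T : measurableType d) (R : realType).
Variables (mu : {measure set T -> \bar R}) (D : set T).
Hypothesis mD : measurable D.
Variables (I : Type) (s : seq I) (e : I -> T -> R) (B G : R).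
Hypothesis me : forall n, measurable_fun D (e n).
Hypothesis eB : forall n x, D x -> `|e n x| <= B.
Hypothesis G0 : 0 < G.
Hypothesis muD : (mu D < +oo)%E.
Hypothesis gram : forall x : I -> R,
  \int[mu]_(t in D) (\sum_(n <- s) x n * e n t) ^+ 2
    <= G * \sum_(n <- s) x n ^+ 2.

(* Expands 0 <= int (f - g / G)^2 for g the sum of c_n e_n, c_n the
   coefficients of f. *)
Lemma bessel_inequality (f : T -> R) :
  mu.-integrable D (EFin \o f) -> mu.-integrable D (EFin \o (fun t => f t ^+ 2)) ->
  \sum_(n <- s) (\int[mu]_(t in D) (f t * e n t)) ^+ 2
    <= G * \int[mu]_(t in D) f t ^+ 2.
Proof.
move=> If If2.
pose c n := \int[mu]_(t in D) (f t * e n t).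
pose g t := \sum_(n <- s) c n * e n t.
have mg : measurable_fun D g.
  by apply: measurable_sum => n; apply: measurable_funM.
have gB t : D t -> `|g t| <= \sum_(n <- s) `|c n| * B.
  move=> Dt; rewrite (le_trans (ler_norm_sum _ _ _))// ler_sum// => n _.
  by rewrite normrM ler_wpM2l// eB.
have Ig2 : mu.-integrable D (EFin \o (fun t => g t ^+ 2)).
  apply: measurable_bounded_integrable => //.
    by apply: measurable_funX.
  exists ((\sum_(n <- s) `|c n| * B) ^+ 2); split; first exact: num_real.
  move=> M MN t Dt /=; rewrite normrX (le_trans _ (ltW MN))// lerXn2r ?nnegrE//.
    exact: le_trans (normr_ge0 _) (gB _ Dt).
  exact: gB.
have Ifg : mu.-integrable D (EFin \o (fun t => f t * g t)).
  exact: (integrable_EFinM_bounded mD If mg gB).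
have Ife n : mu.-integrable D (EFin \o (fun t => f t * e n t)).
  exact: (integrable_EFinM_bounded mD If (me n) (eB n)).
have fgE : \int[mu]_(t in D) (f t * g t) = \sum_(n <- s) c n ^+ 2.
  rewrite (eq_bigr (fun n => \int[mu]_(t in D) (c n * (f t * e n t)))).
    rewrite -Rintegral_sum//; last by move=> n; apply: integrable_EFinZ.
    apply: eq_Rintegral => t _; rewrite mulr_sumr.
    by apply: eq_bigr => n _; ring.
  by move=> n _; rewrite RintegralZl// expr2.
have : 0 <= \int[mu]_(t in D) (f t - G^-1 * g t) ^+ 2.
  by apply: Rintegral_ge0 => t _; exact: sqr_ge0.
rewrite (_ : \int[mu]_(t in D) _ = \int[mu]_(t in D)
    (f t ^+ 2 + (- 2 / G * (f t * g t) + (G^-1) ^+ 2 * g t ^+ 2))); last first.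
  by apply: eq_Rintegral => t _; ring.
have IZ1 := integrable_EFinZ mD (- 2 / G) Ifg.
have IZ2 := integrable_EFinZ mD (G^-1 ^+ 2) Ig2.
rewrite RintegralD//; last exact: integrable_EFinD.
rewrite RintegralD// RintegralZl// RintegralZl// fgE.
have := gram c; rewrite -/(g _) => gr.
have gr' : \int[mu]_(t in D) g t ^+ 2 <= G * \sum_(n <- s) c n ^+ 2 by [].
have := ler_wpM2l (sqr_ge0 G^-1) gr'.
rewrite mulrA (_ : G^-1 ^+ 2 * G = G^-1); last by field; rewrite gt_eqF.
set X := \sum_(n <- s) c n ^+ 2; set F := \int[mu]_(t in D) f t ^+ 2.
move=> h1 h2; have h3 : G^-1 * X <= F by move: h1 h2; lra.
by rewrite mulrC -ler_pdivrMr// mulrC.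
Qed.

End AbstractBessel.

(** * A Hausdorff-Young inequality *)

Section HausdorffYoung.
Variable R : realType.

(** Values of size above [h] become 0 instead of being clipped, so that a given value contributes
    only at heights not below it. The indicator makes measurability a matter of products. *)
Definition trunc (h y : R) := y * \1_(`[- h, h]) y.

Lemma truncE h y : trunc h y = if `|y| <= h then y else 0.
Proof.
rewrite /trunc indicE mem_setE in_itv/= -ler_norml.
by case: ifP; rewrite ?mulr1 ?mulr0.
Qed.

Lemma measurable_trunc h : measurable_fun setT (trunc h).
Proof. by apply: measurable_funM => //; exact: measurable_indic. Qed.

Lemma ler_norm_trunc h y : 0 <= h -> `|trunc h y| <= h.
Proof. by move=> h0; rewrite truncE; case: ifP => // _; rewrite normr0. Qed.

(** Where the truncation removes y, |y| > h, so that |y|^p = |y| |y|^(p - 1) is at least |y| h^(p -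
    1). *)
Lemma trunc_tail h y p : 0 < h -> 1 < p ->
  h `^ (p - 1) * `|y - trunc h y| <= `|y| `^ p.
Proof.
move=> h0 p1; rewrite truncE; case: (leP `|y| h) => [_|hy].
  by rewrite subrr normr0 mulr0 powR_ge0.
have y0 : 0 < `|y| by exact: lt_trans hy.
rewrite subr0 -(mulr_powRB1 (ltW y0)); last exact: lt_trans p1.
rewrite mulrC ler_wpM2l// ge0_ler_powR ?nnegrE// ?ltW//.
by rewrite subr_gt0.
Qed.

Lemma geometric_sum_le (rho : R) (J : nat) : 0 <= rho -> rho < 1 ->
  \sum_(j < J) rho ^+ j <= (1 - rho)^-1.
Proof.
move=> r0 r1; have h : 0 < 1 - rho by rewrite subr_gt0.
rewrite -div1r ler_pdivlMr// mulrC -[1 - rho]opprB mulNr -subrX1 opprB.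
by rewrite gerBl exprn_ge0.
Qed.

(** A geometric series that starts at the first j with A tau^j >= y, hence of order (A / y)^beta
    when y > A. In the induction, y > A removes the term j = 0 and leaves the sum for y / tau; for y
    <= A the full series is the bound. *)
Lemma dyadic_sum_le (tau beta A : R) (J : nat) (y : R) : 1 < tau -> 0 < beta ->
  0 < A -> 0 <= y ->
  y `^ beta * \sum_(j < J | y <= A * tau ^+ j) (tau `^ beta)^-1 ^+ j
    <= A `^ beta / (1 - (tau `^ beta)^-1).
Proof.
move=> tau1 beta0 A0.
have tau0 : 0 < tau by exact: lt_trans tau1.
set rho := (tau `^ beta)^-1.
have tb : 1 < tau `^ beta.
  by have := @gt0_ltr_powR _ _ beta0 1 tau; rewrite powR1 !nnegrE; apply => //; exact: ltW.
have tb0 : 0 < tau `^ beta by exact: lt_trans tb.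
have r0 : 0 < rho by rewrite invr_gt0.
have r1 : rho < 1 by rewrite invf_lt1.
elim: J y => [|J ih] y y0.
  by rewrite big_ord0 mulr0 divr_ge0 ?powR_ge0// subr_ge0 ltW.
have [yA|Ay] := leP y A.
  apply: ler_pM; rewrite ?powR_ge0//.
  - by rewrite sumr_ge0// => j _; rewrite exprn_ge0// ltW.
  - by rewrite ge0_ler_powR// ?nnegrE// ltW.
  - apply: le_trans (geometric_sum_le J.+1 (ltW r0) r1).
    rewrite big_mkcond ler_sum// => j _; case: ifP => // _.
    by rewrite exprn_ge0// ltW.
rewrite big_mkcond big_ord_recl/= expr0 (mulr1 A) (leNgt y A) Ay/= add0r.
apply: le_trans (ih (y / tau) _); last by rewrite divr_ge0// ltW.
rewrite [X in _ <= _ * X]big_mkcond/= !mulr_sumr ler_sum// => j _.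
have yE : y `^ beta = (y / tau) `^ beta * tau `^ beta.
  by rewrite -powRM ?divfK ?gt_eqF// ?divr_ge0// ltW.
rewrite /bump/= add1n exprSr mulrA ler_pdivrMr//.
case: ifP => // _; last by rewrite !mulr0.
by rewrite yE exprSr -/rho mulrACA mulfV ?gt_eqF// mulr1.
Qed.

Lemma exp2V_lt (x : R) : 0 < x -> exists J : nat, 2^-1 ^+ J < x.
Proof.
move=> x0; exists (Num.bound x^-1).
have := archi_boundP (ltW (_ : 0 < x^-1)); rewrite invr_gt0 => /(_ x0) h.
rewrite exprVn invf_plt ?posrE ?exprn_gt0//; apply: (lt_trans h).
by rewrite -natrX ltr_nat ltn_expl.
Qed.

Lemma dyadic_level (S c : R) : 0 < S -> 0 < c -> c <= S ->
  exists j : nat, S * 2^-1 ^+ j.+1 < c <= S * 2^-1 ^+ j.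
Proof.
move=> S0 c0 cS.
have [J] : exists J : nat, S * 2^-1 ^+ J < c.
  have [J HJ] := exp2V_lt (divr_gt0 c0 S0).
  by exists J; rewrite mulrC -ltr_pdivlMr.
elim: J => [|J ih HJ]; first by rewrite expr0 mulr1 ltNge cS.
by have [/ih//|h] := ltP (S * 2^-1 ^+ J) c; exists J; rewrite HJ h.
Qed.

End HausdorffYoung.

(** * Interpolation between Bessel's inequality and the L_1 bound *)

Section HausdorffYoungInequality.
Context d (T : measurableType d) (R : realType).
Variables (mu : {measure set T -> \bar R}) (D : set T).
Hypothesis mD : measurable D.
Hypothesis muD : (mu D < +oo)%E.

Lemma ler_norm_Rintegral_bounded (f e : T -> R) (B : R) : 0 <= B ->
  mu.-integrable D (EFin \o f) -> measurable_fun D e ->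
  (forall x, D x -> `|e x| <= B) ->
  `|\int[mu]_(t in D) (f t * e t)| <= B * \int[mu]_(t in D) `|f t|.
Proof.
move=> B0 If me eB; have Ife := integrable_EFinM_bounded mD If me eB.
have Inf : mu.-integrable D (EFin \o (fun t => `|f t|)) := integrable_norm If.
apply: le_trans (le_normr_Rintegral mD Ife) _.
rewrite -RintegralZl//; apply: le_Rintegral => //.
- exact: integrable_norm.
- exact: integrable_EFinZ.
- by move=> t Dt; rewrite normrM mulrC ler_wpM2r// eB.
Qed.

Lemma ler_powR1D (y p : R) : 1 <= p -> `|y| <= 1 + `|y| `^ p.
Proof.
move=> p1; have [y1|y1] := leP `|y| 1; first by rewrite ler_wpDr// powR_ge0.
by rewrite ler_wpDl// le1r_powR// ltW.
Qed.

Lemma integrable_cst1 : mu.-integrable D (EFin \o (fun=> 1)).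
Proof.
apply: measurable_bounded_integrable => //.
by exists 1; split => // M M1 x _ /=; rewrite normr1 ltW.
Qed.

Lemma integrable_powR (f : T -> R) (p : R) : 1 <= p -> measurable_fun D f ->
  mu.-integrable D (EFin \o (fun t => `|f t| `^ p)) ->
  mu.-integrable D (EFin \o f).
Proof.
move=> p1 mf Ifp.
apply: (@integrable_EFin_le _ _ _ _ _ mD _ (fun t => 1 + `|f t| `^ p)) => //.
  move=> t _; rewrite [leRHS]ger0_norm ?addr_ge0 ?powR_ge0//.
  exact: ler_powR1D.
by apply: integrable_EFinD => //; exact: integrable_cst1.
Qed.

(* The estimates f |-> (int f e_n)_n from L_2 to l_2 and from L_1 to l_oo
   interpolate: on the n with |int f e_n| of order S / 2^j, the part of f
   above the height tau^(j+2) contributes at most half of the coefficient. *)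
Lemma hausdorff_young_dyadic (p q B G K : R) : 1 < p -> p < 2 ->
  q = (2 - p) / (p - 1) -> 0 < B -> 0 < G -> 0 <= K ->
  exists C, forall (I : eqType) (s : seq I) (e : I -> T -> R),
    (forall n, measurable_fun D (e n)) ->
    (forall n x, D x -> `|e n x| <= B) ->
    (forall f : T -> R, mu.-integrable D (EFin \o f) ->
      mu.-integrable D (EFin \o (fun t => f t ^+ 2)) ->
      \sum_(n <- s) (\int[mu]_(t in D) (f t * e n t)) ^+ 2
        <= G * \int[mu]_(t in D) f t ^+ 2) ->
  forall f : T -> R, measurable_fun D f ->
    mu.-integrable D (EFin \o (fun t => `|f t| `^ p)) ->
    \int[mu]_(t in D) (`|f t| `^ p) <= K ->
    \sum_(n <- s) `|\int[mu]_(t in D) (f t * e n t)| `^ (q + 2) <= C.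
Proof.
move=> p1 p2 qE B0 G0 K0.
have p10 : 0 < p - 1 by rewrite subr_gt0.
have p0 : 0 < p by exact: lt_trans p1.
have b0 : 0 < 2 - p by rewrite subr_gt0.
have q0 : 0 < q by rewrite qE divr_gt0.
pose m := fine (mu D).
have m0 : 0 <= m by rewrite fine_ge0.
(* An upper bound for all coefficients, by |f| <= 1 + |f|^p; the added 1 makes it positive. *)
pose S := B * (m + K) + 1.
have S0 : 0 < S by rewrite ltr_wpDl// mulr_ge0// ?addr_ge0// ltW.
(* Chosen so that tau^(p - 1) = 2: by [trunc_tail], raising the height by a factor tau halves the
   bound on the tail, just as the next level halves the coefficients. *)
pose tau := 2 `^ (p - 1)^-1 : R.
have tau1 : 1 < tau.
  by have := @gt0_ltr_powR _ (p - 1)^-1; rewrite invr_gt0 => /(_ p10 1 2);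
    rewrite powR1 !nnegrE; apply => //; rewrite ltr1n.
have tau0 : 0 < tau by exact: lt_trans tau1.
have tauE : tau `^ (p - 1) = 2 by rewrite -powRrM mulVf ?powRr1// gt_eqF.
have tauq : tau `^ (2 - p) = 2 `^ q by rewrite -powRrM mulrC -qE.
(* The extra tau^2 bounds the contribution of the tail by S / 2^(j + 2), at most half of a
   coefficient above S / 2^(j + 1). *)
pose h j := tau ^+ 2 * tau ^+ j.
have h0 j : 0 < h j by rewrite mulr_gt0// exprn_gt0.
have hE j : h j `^ (p - 1) = 2 ^+ j.+2.
  rewrite /h -exprD add2n -powR_mulrn; last exact: ltW.
  by rewrite powRAC tauE powR_mulrn.
(* Equal to 2^-q, the ratio of the bounds on |c n|^q at consecutive levels, but written in the form
   of [dyadic_sum_le]. *)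
pose rho : R := (tau `^ (2 - p))^-1.
pose X := (tau ^+ 2) `^ (2 - p) / (1 - rho).
exists (4 * S `^ q * G * X * K) => I s e me eB bes f mf Ifp fK.
have fle t : `|f t| <= 1 + `|f t| `^ p by exact: ler_powR1D (ltW p1).
have I1 := integrable_cst1.
have If := integrable_powR (ltW p1) mf Ifp.
pose c n := \int[mu]_(t in D) (f t * e n t).
have f1le : \int[mu]_(t in D) `|f t| <= m + K.
  apply: (@le_trans _ _ (\int[mu]_(t in D) (1 + `|f t| `^ p))).
    apply: le_Rintegral => //; first exact: integrable_norm.
    exact: integrable_EFinD.
  by rewrite RintegralD// Rintegral_cst// mul1r lerD2l.
have cS n : `|c n| <= S.
  apply: (le_trans (ler_norm_Rintegral_bounded (ltW B0) If (me n) (eB n))).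
  by rewrite /S ler_wpDr// ler_wpM2l// ltW.
pose F j t := trunc (h j) (f t).
have mF j : measurable_fun D (F j).
  exact: (measurableT_comp (measurable_trunc (h j)) mf).
have IF j : mu.-integrable D (EFin \o F j).
  apply: (integrable_EFin_le mD (mF j) _ If) => t _; rewrite /F truncE.
  by case: ifP => // _; rewrite normr0.
have IF2 j : mu.-integrable D (EFin \o (fun t => F j t ^+ 2)).
  apply: measurable_bounded_integrable => //; first exact: measurable_funX.
  exists (h j ^+ 2); split; first exact: num_real.
  move=> M MN t _ /=; rewrite normrX (le_trans _ (ltW MN))// lerXn2r ?nnegrE//.
    exact: ltW.
  by apply: ler_norm_trunc; exact: ltW.
pose a n j := \int[mu]_(t in D) (F j t * e n t).
have ca n j : `|c n - a n j| <= S * 2^-1 ^+ j.+2.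
  have IfF : mu.-integrable D (EFin \o (fun t => f t - F j t)).
    exact: (integrableB mD If (IF j)).
  rewrite -RintegralB//; [|exact: (integrable_EFinM_bounded mD If (me n) (eB n))
    |exact: (integrable_EFinM_bounded mD (IF j) (me n) (eB n))].
  under eq_Rintegral do rewrite -mulrBl.
  apply: (le_trans (ler_norm_Rintegral_bounded (ltW B0) IfF (me n) (eB n))).
  have tail : 2 ^+ j.+2 * \int[mu]_(t in D) `|f t - F j t| <= K.
    apply: le_trans fK; rewrite -hE -RintegralZl//; last exact: integrable_norm.
    apply: le_Rintegral => //.
      by apply: integrable_EFinZ => //; exact: integrable_norm.
    by move=> t _; exact: trunc_tail.
  rewrite exprVn ler_pdivlMr ?exprn_gt0// -mulrA [_ * 2 ^+ _]mulrC.
  apply: (le_trans (ler_wpM2l (ltW B0) tail)).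
  by rewrite /S ler_wpDr// ler_wpM2l ?(ltW B0)// ler_wpDl.
have half_powR j : (2^-1 ^+ j) `^ q = rho ^+ j.
  rewrite -(@powR_mulrn _ 2^-1) ?invr_ge0// powRAC powR_mulrn ?powR_ge0//.
  congr (_ ^+ _).
  by rewrite -powR_inv1// -powRrM mulN1r powRN /rho tauq.
(* On level j, |c n| <= 2 |a n j|. Of the power q + 2, the part q is bounded by the level and the
   square by that of the truncated coefficient, to which Bessel's inequality applies. *)
have level n j : S * 2^-1 ^+ j.+1 < `|c n| <= S * 2^-1 ^+ j ->
    `|c n| `^ (q + 2) <= 4 * S `^ q * rho ^+ j * a n j ^+ 2.
  move=> /andP[c1 c2].
  rewrite powRD ?(gt_eqF (addr_gt0 q0 _))// powR_mulrn//.
  rewrite (_ : 4 * _ * _ * _ = (S `^ q * rho ^+ j) * (2 * `|a n j|) ^+ 2); last first.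
    by rewrite exprMn real_normK ?num_real//; ring.
  apply: ler_pM; rewrite ?powR_ge0 ?sqr_ge0//.
    rewrite -half_powR -powRM ?exprn_ge0 ?(ltW S0)//.
    by rewrite ge0_ler_powR ?nnegrE ?(ltW q0)// (le_trans _ c2).
  rewrite lerXn2r ?nnegrE// ?mulr_ge0//.
  have := ca n j; rewrite exprS mulrCA => ca'.
  have := ler_normD (c n - a n j) (a n j); rewrite subrK.
  by move: c1 ca'; lra.
(* The list is finite, so finitely many levels serve all its nonzero coefficients; a vanishing
   coefficient lies on no level and contributes 0. The final constant does not depend on [J]. *)
have [J HJ] : exists J : nat, forall n, n \in s ->
    `|c n| `^ (q + 2) <= \sum_(j < J) 4 * S `^ q * rho ^+ j * a n j ^+ 2.
  have term_ge0 n j : 0 <= 4 * S `^ q * rho ^+ j * a n j ^+ 2.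
    rewrite mulr_ge0 ?sqr_ge0// mulr_ge0 ?exprn_ge0 ?invr_ge0 ?powR_ge0//.
    by rewrite mulr_ge0// powR_ge0.
  have ex n : exists J : nat, forall J', (J <= J')%N ->
      `|c n| `^ (q + 2) <= \sum_(j < J') 4 * S `^ q * rho ^+ j * a n j ^+ 2.
    have [->|cn0] := eqVneq (c n) 0.
      exists 0%N => J' _; rewrite normr0 powR0 ?sumr_ge0//.
      by rewrite gt_eqF// addr_gt0.
    have [||j Hj] := @dyadic_level _ S `|c n| S0; [by rewrite normr_gt0|exact: cS|].
    exists j.+1 => J' jJ'; rewrite (bigD1 (Ordinal jJ'))//= ler_wpDr ?sumr_ge0//.
    exact: level.
  elim: (s) => [|n r [J HJ]]; first by exists 0%N.
  have [J' HJ'] := ex n.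
  exists (maxn J J') => k; rewrite in_cons => /predU1P[->|kr].
    by apply: HJ'; rewrite leq_maxr.
  apply: le_trans (HJ _ kr) _.
  rewrite -(subnKC (leq_maxl J J')) big_split_ord/= ler_wpDr ?sumr_ge0//.
apply: (@le_trans _ _ (\sum_(n <- s) \sum_(j < J)
    4 * S `^ q * rho ^+ j * a n j ^+ 2)).
  by rewrite big_seq [leRHS]big_seq; apply: ler_sum => n ns; exact: HJ.
rewrite exchange_big/=.
apply: (@le_trans _ _ (\sum_(j < J)
    4 * S `^ q * G * \int[mu]_(t in D) (rho ^+ j * F j t ^+ 2))).
  apply: ler_sum => j _.
  rewrite RintegralZl// -mulr_sumr.
  rewrite [leRHS](_ : _ = 4 * S `^ q * rho ^+ j *
    (G * \int[mu]_(t in D) F j t ^+ 2)); last by ring.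
  rewrite ler_wpM2l//; last exact: bes.
  by rewrite !mulr_ge0 ?powR_ge0// exprn_ge0// invr_ge0 powR_ge0.
rewrite -mulr_sumr -Rintegral_sum//; last first.
  by move=> j; apply: integrable_EFinZ.
rewrite -[leRHS]mulrA ler_wpM2l//.
  by rewrite !mulr_ge0// ?powR_ge0// ltW.
have X0 : 0 <= X.
  rewrite divr_ge0 ?powR_ge0// subr_ge0 invf_le1 ?powR_gt0//.
  by have := ler_powR (ltW tau1) (ltW b0); rewrite powRr0.
apply: le_trans (ler_wpM2l X0 fK); rewrite -RintegralZl//.
apply: le_Rintegral => //.
- by apply: integrable_EFin_sum => // j; exact: integrable_EFinZ.
- exact: integrable_EFinZ.
move=> t _.
(* Pointwise, the sum over j of rho^j (F j t)^2 is f^2 times the sum of rho^j over the heights h j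
   >= |f|, at most X |f|^p. *)
have := @dyadic_sum_le _ tau (2 - p) (tau ^+ 2) J `|f t|
  tau1 b0 (exprn_gt0 2 tau0) (normr_ge0 _).
move=> /(ler_wpM2r (powR_ge0 `|f t| p)); rewrite -/rho -/X; apply: le_trans.
rewrite mulrAC -powRD; last by rewrite subrK pnatr_eq0.
rewrite subrK powR_mulrn// mulr_sumr [leRHS]big_mkcond; apply: ler_sum => j _.
rewrite /F truncE -/(h j); case: ifP => _; last by rewrite expr0n mulr0.
by rewrite mulrC real_normK// num_real.
Qed.

End HausdorffYoungInequality.

(** * Waves with frequencies close to the even integers *)

Section SummableInt.
Variable R : realType.

(** Otherwise there are duplicate-free lists of any length with all g n > eta, each new index being
    larger in absolute value than the earlier ones, and their sums exceed [K]. *)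
Lemma bounded_sums_vanish (g : int -> R) (K eta : R) : (forall n, 0 <= g n) ->
  (forall s, uniq s -> \sum_(n <- s) g n <= K) -> 0 < eta ->
  exists N : nat, forall n : int, (N <= `|n|)%N -> g n <= eta.
Proof.
move=> g0 gK eta0; apply: contrapT => /forallNP H.
have big N : exists2 n : int, (N <= `|n|)%N & eta < g n.
  have /existsNP[n /not_implyP[Nn /negP gn]] := H N.
  by exists n => //; rewrite ltNge.
have ex (k : nat) : exists2 s : seq int, uniq s & eta *+ k <= \sum_(n <- s) g n.
  elim: k => [|k [s us sk]]; first by exists [::]; rewrite ?big_nil.
  have [n nN gn] := big (\max_(m <- s) `|m|%N).+1.
  exists (n :: s); last by rewrite big_cons mulrS lerD// ltW.
  rewrite /= us andbT; apply/negP => ns; move: nN; rewrite ltnNge => /negP.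
  by apply; apply: (@leq_bigmax_seq _ _ xpredT (fun m : int => `|m|%N)).
have K0 : 0 <= K by have := gK [::] isT; rewrite big_nil.
have [s us sk] := ex (Num.bound (K / eta)).
have := archi_boundP (divr_ge0 K0 (ltW eta0)).
apply/negP; rewrite -leNgt ler_pdivlMr// mulr_natl.
exact: le_trans sk (gK _ us).
Qed.

End SummableInt.

Section Truncation.
Context d (T : measurableType d) (R : realType).
Variables (mu : {measure set T -> \bar R}) (D : set T).
Hypothesis mD : measurable D.

(** Dominated convergence along the heights n + 1, with majorant |f|: at each point the difference
    is eventually 0. *)
Lemma trunc_approx (f : T -> R) (eta : R) : mu.-integrable D (EFin \o f) ->
  0 < eta -> exists2 h, 0 < h &
    \int[mu]_(t in D) `|f t - trunc h (f t)| <= eta.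
Proof.
move=> If eta0.
have mf := integrable_EFin_measurable If.
pose g (n : nat) t : \bar R := (`|f t - trunc n.+1%:R (f t)|)%:E.
have mg n : measurable_fun D (g n).
  apply/measurable_EFinP; apply: measurableT_comp => //.
  apply: measurable_funB => //.
  exact: measurableT_comp (measurable_trunc _) mf.
have g0 t : D t -> g n t @[n --> \oo] --> 0%E.
  move=> _; apply: cvg_near_cst; exists (Num.bound `|f t|) => // n /= tn.
  rewrite /g truncE ifT ?subrr ?normr0//.
  apply: le_trans (ltW (archi_boundP (normr_ge0 (f t)))) _.
  by rewrite ler_nat ltnW.
have If1 : mu.-integrable D (EFin \o (fun t => `|f t|)) := integrable_norm If.
have gf n t : D t -> (`|g n t| <= (EFin \o (fun t => `|f t|%R)) t)%E.
  move=> _; rewrite /g /= lee_fin normr_id truncE.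
  by case: ifP; rewrite ?subrr ?normr0// subr0.
have fing t : D t -> (EFin \o (fun t => `|f t|%R)) t \is a fin_num by [].
have := dominated_cvg mD mg g0 fing If1 gf.
rewrite integral0 => /fine_cvgP[_] /cvgrPdist_le /(_ eta eta0)[n _ /(_ n)].
rewrite /= leqnn => /(_ isT); rewrite sub0r normrN => gn.
exists n.+1%:R => //; apply: le_trans gn.
by rewrite ger0_norm// fine_ge0// integral_ge0// => t _; rewrite lee_fin.
Qed.

End Truncation.

Section WaveFamily.
Variable R : realType.
Local Notation mu := (@lebesgue_measure R).
Variables (al be : R).
Hypotheses (al0 : 0 <= al) (be0 : 0 <= be).

Definition wave_family (a b : int -> R) : Prop :=
  (forall n, `|a n| <= al) /\ (forall n, `|b n - 2 * n%:~R| <= be).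

Let B := expR (2 * pi * al).

Lemma mu0pi : (mu `[0%R, pi%R] < +oo)%E.
Proof.
by rewrite /= lebesgue_measure_itv/=; case: ifP => // _; rewrite -EFinB ltry.
Qed.

Lemma wave_family_bounded a b th n (t : R) : wave_family a b ->
  `[0, pi]%classic t -> `|wave (a n) (b n) (th n) t| <= B.
Proof.
move=> [aal _]; rewrite /= in_itv/= => /andP[t0 tpi].
apply: ler_norm_wave => //; rewrite ger0_norm// (le_trans tpi)//.
by have := @pi_ge0 R; lra.
Qed.

Lemma bessel_waves : exists2 G, 0 < G & forall a b th, wave_family a b ->
  forall s : seq int, uniq s -> forall f : R -> R,
    mu.-integrable `[0, pi] (EFin \o f) ->
    mu.-integrable `[0, pi] (EFin \o (fun t => f t ^+ 2)) ->
    \sum_(n <- s) (\int[mu]_(t in `[0, pi]) (f t * wave (a n) (b n) (th n) t)) ^+ 2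
      <= G * \int[mu]_(t in `[0, pi]) f t ^+ 2.
Proof.
have [G G0 HG] := gram_waves al0 be0.
exists G => // a b th ab s us f If If2.
apply: (bessel_inequality _ _ _ G0 mu0pi _ If If2) => //.
- by move=> n; exact: measurable_wave.
- by move=> n x; exact: wave_family_bounded.
- by move=> x; apply: (HG _ _ _ ab.1 ab.2).
Qed.

(** Moving the cut-off at x from the interval into the function turns estimates over [0, pi] into
    estimates uniform in x. *)
Lemma integral_itv0E (f e : R -> R) x : 0 <= x <= pi ->
  \int[mu]_(t in `[0, x]) (f t * e t) =
  \int[mu]_(t in `[0, pi]) ((f \_ `[0, x]) t * e t).
Proof.
move=> /andP[x0 xpi].
have sub : `[0, x] `<=` `[(0 : R), pi] by apply: subset_itvl.
rewrite -{1}(setIidr sub) Rintegral_mkcondr; apply: eq_Rintegral => t _.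
by rewrite !patchE; case: ifP => // _; rewrite mul0r.
Qed.

Lemma measurable_patch0pi (f : R -> R) x : 0 <= x <= pi ->
  measurable_fun `[0, pi] f -> measurable_fun `[0, pi] (f \_ `[0, x]).
Proof.
move=> /andP[x0 xpi] mf.
have sub : `[0, x] `<=` `[(0 : R), pi] by apply: subset_itvl.
apply/measurable_restrict => //; rewrite (setIidr sub).
exact: measurable_funS mf.
Qed.

Lemma ler_norm_patch (f : R -> R) x t : `|(f \_ `[0, x]) t| <= `|f t|.
Proof. by rewrite patchE; case: ifP => // _; rewrite normr0. Qed.

Lemma hausdorff_young_waves (p p' K : R) : 1 < p -> p <= 2 ->
  p^-1 + p'^-1 = 1 -> 0 <= K ->
  exists C, forall a b th, wave_family a b ->
  forall s : seq int, uniq s -> forall f : R -> R,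
    measurable_fun `[0, pi] f ->
    mu.-integrable `[0, pi] (EFin \o (fun t => `|f t| `^ p)) ->
    \int[mu]_(t in `[0, pi]) (`|f t| `^ p) <= K ->
  forall x, 0 <= x <= pi ->
    \sum_(n <- s) `|\int[mu]_(t in `[0, x]) (f t * wave (a n) (b n) (th n) t)| `^ p'
      <= C.
Proof.
move=> p1 p2 pp' K0.
have p0 : 0 < p by exact: lt_trans p1.
suff [C HC] : exists C, forall a b th, wave_family a b ->
    forall s : seq int, uniq s -> forall f : R -> R,
    measurable_fun `[0, pi] f ->
    mu.-integrable `[0, pi] (EFin \o (fun t => `|f t| `^ p)) ->
    \int[mu]_(t in `[0, pi]) (`|f t| `^ p) <= K ->
    \sum_(n <- s) `|\int[mu]_(t in `[0, pi]) (f t * wave (a n) (b n) (th n) t)| `^ p'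
      <= C.
  exists C => a b th ab s us f mf Ifp fK x x0pi.
  under eq_bigr do rewrite integral_itv0E//.
  have mfx := measurable_patch0pi x0pi mf.
  have mfxp : measurable_fun `[0, pi] (fun t => `|(f \_ `[0, x]) t| `^ p).
    apply: (measurableT_comp (measurable_powR p)) => //.
    exact: measurableT_comp mfx.
  have le t : `|(f \_ `[0, x]) t| `^ p <= `|f t| `^ p.
    by rewrite ge0_ler_powR ?nnegrE ?ler_norm_patch// ltW.
  have Ifx : mu.-integrable `[0, pi] (EFin \o (fun t => `|(f \_ `[0, x]) t| `^ p)).
    apply: (@integrable_EFin_le _ _ _ mu _ (measurable_itv _) _ _ mfxp _ Ifp) => t _.
    by rewrite !(ger0_norm (powR_ge0 _ _)).
  apply: (HC _ _ _ ab s us _ mfx Ifx); apply: le_trans fK; exact: le_Rintegral.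
have [G G0 HG] := bessel_waves.
(* At p = 2 the claim is Bessel's inequality itself; the dyadic argument covers p < 2. *)
case: (ltgtP p 2) p2 => // [p2 _|pE _]; last first.
  have p'E : p' = 2 by apply: invr_inj; move: pp'; rewrite pE; lra.
  exists (G * K) => a b th ab s us f mf Ifp fK.
  have fE : (fun t => `|f t| `^ p) = (fun t => f t ^+ 2).
    by apply/funext => t; rewrite pE powR_mulrn// real_normK// num_real.
  rewrite p'E; under eq_bigr do rewrite powR_mulrn// real_normK ?num_real//.
  move: Ifp fK; rewrite fE => If2 fK; apply: le_trans (_ : G * _ <= _); last first.
    by apply: ler_wpM2l fK; exact: ltW.
  apply: HG => //.
  apply: (@integrable_powR _ _ _ mu _ (measurable_itv _) mu0pi f p) => //.
    exact: ltW.
  by rewrite fE.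
have qE : p' = (2 - p) / (p - 1) + 2.
  apply: invr_inj; rewrite -(addKr p^-1 p'^-1) pp'.
  by field; apply/andP; split; rewrite gt_eqF//; lra.
have [C HC] := @hausdorff_young_dyadic _ _ _ mu _ (measurable_itv `[0, pi]) mu0pi
  p _ B G K p1 p2 erefl (expR_gt0 _) G0 K0.
exists C => a b th ab s us f mf Ifp fK; rewrite qE.
apply: (HC _ s (fun n => wave (a n) (b n) (th n))) => //.
- by move=> n; exact: measurable_wave.
- by move=> n x; exact: wave_family_bounded.
- exact: HG.
Qed.

Lemma integrable_patch0pi (f : R -> R) x : 0 <= x <= pi ->
  mu.-integrable `[0, pi] (EFin \o f) ->
  mu.-integrable `[0, pi] (EFin \o (f \_ `[0, x])).
Proof.
move=> x0pi If.
have mfx := measurable_patch0pi x0pi (integrable_EFin_measurable If).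
apply: (@integrable_EFin_le _ _ _ mu _ (measurable_itv _) _ _ mfx _ If) => t _.
exact: ler_norm_patch.
Qed.

Lemma ler_norm_integral_wave a b th n (f : R -> R) x : wave_family a b ->
  mu.-integrable `[0, pi] (EFin \o f) -> 0 <= x <= pi ->
  `|\int[mu]_(t in `[0, x]) (f t * wave (a n) (b n) (th n) t)|
    <= B * \int[mu]_(t in `[0, pi]) `|f t|.
Proof.
move=> ab If x0pi; rewrite integral_itv0E//.
have Ifx := integrable_patch0pi x0pi If.
have B0 : 0 <= B by exact: expR_ge0.
apply: le_trans (@ler_norm_Rintegral_bounded _ _ _ mu _ (measurable_itv _) _ _ B
  B0 Ifx (@measurable_wave _ _ _ _ _) _) _.
  by move=> t; exact: wave_family_bounded.
rewrite ler_wpM2l// le_Rintegral//; [exact: integrable_norm..|].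
by move=> t _; exact: ler_norm_patch.
Qed.

(** For fixed x the squares have bounded sums by Bessel's inequality, so the coefficients tend to 0.
    They are Lipschitz in x with a constant independent of n, which reduces uniformity in x to
    finitely many grid points. *)
Lemma riemann_lebesgue_bounded a b th (f : R -> R) (h : R) : wave_family a b ->
  measurable_fun `[0, pi] f -> 0 < h ->
  (forall t, `|f t| <= h) ->
  forall eta : R, 0 < eta -> exists N : nat, forall n : int, (N <= `|n|)%N ->
  forall x, 0 <= x <= pi ->
    `|\int[mu]_(t in `[0, x]) (f t * wave (a n) (b n) (th n) t)| <= eta.
Proof.
move=> ab mf h0 fh.
pose c n x := \int[mu]_(t in `[0, x]) (f t * wave (a n) (b n) (th n) t).
have pi0 := @pi_ge0 R.
have B0 : 0 < B by exact: expR_gt0.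
have If : mu.-integrable `[0, pi] (EFin \o f).
  by have [] := @Rintegral_bounded R f 0 pi h pi0 mf (fun t _ => fh t).
have pointwise (x : R) : 0 <= x <= pi -> forall eta : R, 0 < eta ->
    exists N : nat, forall n : int, (N <= `|n|)%N -> `|c n x| <= eta.
  move=> x0pi eta eta0; have [G G0 HG] := bessel_waves.
  have mfx := measurable_patch0pi x0pi mf.
  have Ifx := integrable_patch0pi x0pi If.
  have Ifx2 : mu.-integrable `[0, pi] (EFin \o (fun t => (f \_ `[0, x]) t ^+ 2)).
    have mfx2 : measurable_fun `[0, pi] (fun t => (f \_ `[0, x]) t ^+ 2).
      exact: measurable_funX.
    have [] // := @Rintegral_bounded R _ 0 pi (h ^+ 2) pi0 mfx2.
    move=> t _; rewrite normrX lerXn2r ?nnegrE// ?(ltW h0)//.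
    by rewrite (le_trans (ler_norm_patch _ _ _)).
  have [|||N HN] := @bounded_sums_vanish R (fun n => c n x ^+ 2)
      (G * \int[mu]_(t in `[0, pi]) (f \_ `[0, x]) t ^+ 2) (eta ^+ 2).
  - by move=> n; exact: sqr_ge0.
  - move=> s us; rewrite /c; under eq_bigr do rewrite integral_itv0E//.
    exact: HG.
  - by rewrite exprn_gt0.
  exists N => n /HN; rewrite -(real_normK (num_real (c n x))).
  by rewrite ler_pXn2r ?nnegrE ?(ltW eta0).
have lip n x y : 0 <= x -> x <= y -> y <= pi ->
    `|c n y| <= `|c n x| + h * B * (y - x).
  move=> x0 xy ypi.
  have Ie : mu.-integrable `[0, pi]
      (EFin \o (fun t => f t * wave (a n) (b n) (th n) t)).
    apply: (@integrable_EFinM_bounded _ _ _ mu _ (measurable_itv _) _ _ B If).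
      exact: measurable_wave.
    by move=> t; exact: wave_family_bounded.
  have IS u v : 0 <= u -> v <= pi -> mu.-integrable `[u, v]
      (EFin \o (fun t => f t * wave (a n) (b n) (th n) t)).
    move=> u0 vpi; apply: integrableS Ie => //.
    by apply: subset_itv; rewrite bnd_simp.
  rewrite -lerBlDl; apply: le_trans (lerB_dist _ _) _.
  rewrite /c Rintegral_itvB ?bnd_simp//; last exact: IS.
  rewrite Rintegral_itv_obnd_cbnd//; last first.
    apply: integrableS (IS x y _ _) => //; exact: subset_itv_oc_cc.
  have mfe := integrable_EFin_measurable (IS _ _ x0 ypi).
  apply: (Rintegral_bounded xy mfe _).2.
  move=> t /andP[xt ty]; rewrite normrM ler_pM//.
  apply: wave_family_bounded => //.
  by rewrite /= in_itv/= (le_trans x0 xt) (le_trans ty ypi).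
move=> eta eta0.
(* Mesh of the grid: a step of length [del] raises |c n x| by at most eta / 2. *)
pose del := eta / 2 / (h * B).
have hB0 : 0 < h * B by exact: mulr_gt0.
have del0 : 0 < del by rewrite !divr_gt0.
have steps (k : nat) : exists N : nat, forall n : int, (N <= `|n|)%N ->
    forall x, 0 <= x <= pi -> x <= del *+ k -> `|c n x| <= eta.
  elim: k => [|k [N HN]].
    exists 0%N => n _ x /andP[x0 _] x0'.
    have -> : x = 0 by apply/le_anti; rewrite x0 -(mulr0n del) x0'.
    by rewrite /c set_itv1 Rintegral_set1 normr0 ltW.
  (* If the grid point lies beyond pi, all of [0, pi] is covered already. *)
  have [kpi|kpi] := leP (del *+ k) pi; last first.
    by exists N => n /HN Hn x x0pi _; apply: Hn => //; have /andP[] := x0pi; lra.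
  have k0 : 0 <= del *+ k by rewrite mulrn_wge0// ltW.
  have [|N' HN'] := pointwise (del *+ k) _ (eta / 2) (divr_gt0 eta0 (ltr0n _ 2)).
    by rewrite k0.
  exists (maxn N N') => n; rewrite geq_max => /andP[nN nN'] x x0pi xk.
  have [xk'|xk'] := leP x (del *+ k); first exact: HN.
  have /andP[x0 xpi] := x0pi.
  apply: (le_trans (lip n _ _ k0 (ltW xk') xpi)).
  rewrite [leRHS](splitr eta) lerD ?HN'//.
  rewrite -ler_pdivlMl// mulrC lerBlDl -mulrSr.
  exact: xk.
have [N HN] := steps (Num.bound (pi / del)).
exists N => n /HN Hn x x0pi; apply: Hn => //.
have /andP[_ xpi] := x0pi; apply: (le_trans xpi).
rewrite -mulr_natr -ler_pdivrMl// mulrC.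
by rewrite ltW// archi_boundP// divr_ge0// ltW.
Qed.

(** The part of f above a large height has small L_1 norm and contributes at most [B] times that
    norm for all n and x; the rest is bounded. *)
Lemma riemann_lebesgue_waves a b th (f : R -> R) : wave_family a b ->
  mu.-integrable `[0, pi] (EFin \o f) ->
  forall eta : R, 0 < eta -> exists N : nat, forall n : int, (N <= `|n|)%N ->
  forall x, 0 <= x <= pi ->
    `|\int[mu]_(t in `[0, x]) (f t * wave (a n) (b n) (th n) t)| <= eta.
Proof.
move=> ab If eta eta0.
have mf := integrable_EFin_measurable If.
have B0 : 0 < B by exact: expR_gt0.
have eB0 : 0 < eta / 2 / B by rewrite !divr_gt0.
have [h h0 fh] := @trunc_approx _ _ R mu _ (measurable_itv _) f _ If eB0.
pose g t := trunc h (f t).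
have mg : measurable_fun `[0, pi] g := measurableT_comp (measurable_trunc h) mf.
have [|N HN] := riemann_lebesgue_bounded th ab mg h0 _ (divr_gt0 eta0 (ltr0n _ 2)).
  by move=> t; apply: ler_norm_trunc; exact: ltW.
exists N => n /HN Hn x x0pi.
have Ig : mu.-integrable `[0, pi] (EFin \o g).
  apply: (@integrable_EFin_le _ _ _ mu _ (measurable_itv _) _ _ mg _ If) => t _.
  by rewrite /g truncE; case: ifP => // _; rewrite normr0.
have Ifg : mu.-integrable `[0, pi] (EFin \o (fun t => f t - g t)).
  exact: (@integrableB _ _ _ mu _ (measurable_itv _) _ _ If Ig).
have Ie (k : R -> R) : mu.-integrable `[0, pi] (EFin \o k) ->
    mu.-integrable `[0, x] (EFin \o (fun t => k t * wave (a n) (b n) (th n) t)).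
  have /andP[x0 xpi] := x0pi.
  move=> Ik; apply: (@integrableS _ _ _ mu `[0, pi]) => //.
    exact: subset_itvl.
  apply: (@integrable_EFinM_bounded _ _ _ mu _ (measurable_itv _) _ _ B Ik).
    exact: measurable_wave.
  by move=> t; exact: wave_family_bounded.
have -> : \int[mu]_(t in `[0, x]) (f t * wave (a n) (b n) (th n) t) =
    \int[mu]_(t in `[0, x]) ((f t - g t) * wave (a n) (b n) (th n) t) +
    \int[mu]_(t in `[0, x]) (g t * wave (a n) (b n) (th n) t).
  rewrite -RintegralD//; [|exact: Ie..].
  by apply: eq_Rintegral => t _; rewrite -mulrDl subrK.
apply: le_trans (ler_normD _ _) _; rewrite (splitr eta) lerD ?Hn//.
apply: le_trans (ler_norm_integral_wave _ _ ab Ifg x0pi) _.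
by rewrite mulrC -ler_pdivlMr.
Qed.

End WaveFamily.

(** * Complex Fourier integrals as sums of real wave integrals *)

Section ComplexKernels.
Local Open Scope complex_scope.
Variable R : realType.
Local Notation mu := (@lebesgue_measure R).
Local Notation Re := complex.Re.
Local Notation Im := complex.Im.
Local Notation normc := ComplexField.Normc.normc.
Implicit Types z w : R[i].

Lemma ReM z w : Re (z * w) = Re z * Re w - Im z * Im w.
Proof. by case: z; case: w. Qed.

Lemma ImM z w : Im (z * w) = Re z * Im w + Im z * Re w.
Proof. by case: z => a b; case: w. Qed.

Lemma ReD z w : Re (z + w) = Re z + Re w.
Proof. by case: z; case: w. Qed.

Lemma ImD z w : Im (z + w) = Im z + Im w.
Proof. by case: z; case: w. Qed.

Lemma ReN z : Re (- z) = - Re z. Proof. by case: z. Qed.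

Lemma normc_ge0 z : 0 <= normc z.
Proof. by case: z => a b; exact: sqrtr_ge0. Qed.

Lemma normc_le z : normc z <= `|Re z| + `|Im z|.
Proof.
case: z => a b /=; rewrite -[leRHS]ger0_norm ?addr_ge0// -sqrtr_sqr ler_sqrt ?sqr_ge0//.
rewrite sqrrD !real_normK ?num_real//.
by rewrite addrAC lerDl mulrn_wge0// mulr_ge0.
Qed.

Lemma normc_ge_Re z : `|Re z| <= normc z.
Proof.
case: z => a b /=; rewrite -sqrtr_sqr ler_sqrt ?addr_ge0 ?sqr_ge0//.
by rewrite lerDl sqr_ge0.
Qed.

Lemma normc_ge_Im z : `|Im z| <= normc z.
Proof.
case: z => a b /=; rewrite -sqrtr_sqr ler_sqrt ?addr_ge0 ?sqr_ge0//.
by rewrite lerDr sqr_ge0.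
Qed.

Lemma wave_sin a b (t : R) : wave a b (- (pi / 2)) t = expR (a * t) * sin (b * t).
Proof. by rewrite /wave cosB cos_pihalf sin_pihalf mulr0 mulr1 add0r. Qed.

Lemma wave_cos a b (t : R) : wave a b 0 t = expR (a * t) * cos (b * t).
Proof. by rewrite /wave addr0. Qed.

Lemma natc (n : nat) : n%:R = n%:R%:C :> R[i].
Proof. by rewrite rmorph_nat. Qed.

Lemma csin_xy (x y : R) : csin (x +i* y) =
  ((expR (- y) + expR y) * sin x / 2) +i* ((expR y - expR (- y)) * cos x / 2).
Proof.
rewrite /csin /cexp.
rewrite (_ : ci R * (x +i* y) = (- y) +i* x); last first.
  by apply/eqP; rewrite eq_complex /= !mul0r !mul1r sub0r add0r !eqxx.
rewrite (_ : - ((- y) +i* x) = y +i* (- x)); last first.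
  by apply/eqP; rewrite eq_complex /= opprK !eqxx.
rewrite (_ : 2%:R * ci R = 0 +i* 2); last first.
  by rewrite natc; apply/eqP; rewrite eq_complex /= !mulr0 !mul0r subr0 addr0 mulr1 !eqxx.
rewrite /= cosN sinN; apply: (canLR (mulfK _)).
  by rewrite eq_complex /= eqxx/= pnatr_eq0.
apply/eqP; rewrite eq_complex /=; apply/andP; split; apply/eqP; by field.
Qed.

Lemma ccos_xy (x y : R) : ccos (x +i* y) =
  ((expR (- y) + expR y) * cos x / 2) +i* ((expR (- y) - expR y) * sin x / 2).
Proof.
rewrite /ccos /cexp.
rewrite (_ : ci R * (x +i* y) = (- y) +i* x); last first.
  by apply/eqP; rewrite eq_complex /= !mul0r !mul1r sub0r add0r !eqxx.
rewrite (_ : - ((- y) +i* x) = y +i* (- x)); last first.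
  by apply/eqP; rewrite eq_complex /= opprK !eqxx.
rewrite natc /= cosN sinN; apply: (canLR (mulfK _)).
  by rewrite eq_complex /= eqxx/= pnatr_eq0.
apply/eqP; rewrite eq_complex /=; apply/andP; split; apply/eqP; by field.
Qed.

Lemma scaled_argument z (t : R) :
  2%:R * z * t%:C = (2 * Re z * t) +i* (2 * Im z * t).
Proof.
case: z => u v; rewrite natc; apply/eqP; rewrite eq_complex /=.
by apply/andP; split; apply/eqP; ring.
Qed.

Lemma csin_waves z (t : R) : csin (2%:R * z * t%:C) =
  ((wave (- (2 * Im z)) (2 * Re z) (- (pi / 2)) t
    + wave (2 * Im z) (2 * Re z) (- (pi / 2)) t) / 2)
  +i* ((wave (2 * Im z) (2 * Re z) 0 t - wave (- (2 * Im z)) (2 * Re z) 0 t) / 2).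
Proof.
rewrite scaled_argument csin_xy !wave_sin !wave_cos -mulrBl -mulrDl.
by rewrite (mulNr _ t).
Qed.

Lemma ccos_waves z (t : R) : ccos (2%:R * z * t%:C) =
  ((wave (- (2 * Im z)) (2 * Re z) 0 t + wave (2 * Im z) (2 * Re z) 0 t) / 2)
  +i* ((wave (- (2 * Im z)) (2 * Re z) (- (pi / 2)) t
    - wave (2 * Im z) (2 * Re z) (- (pi / 2)) t) / 2).
Proof.
rewrite scaled_argument ccos_xy !wave_sin !wave_cos -mulrBl -mulrDl.
by rewrite (mulNr _ t).
Qed.

Definition wave_coef (f : R -> R) (a b th x : R) : R :=
  \int[mu]_(t in `[0, x]) (f t * wave a b th t).

(** The four waves into which both sin(2 z t) and cos(2 z t) decompose: exponents 2 Im z and - 2 Im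
    z, phases 0 and - pi / 2. *)
Definition wave_coefs (f : R -> R) z x : R :=
  (`|wave_coef f (2 * Im z) (2 * Re z) 0 x|
    + `|wave_coef f (2 * Im z) (2 * Re z) (- (pi / 2)) x|)
  + (`|wave_coef f (- (2 * Im z)) (2 * Re z) 0 x|
    + `|wave_coef f (- (2 * Im z)) (2 * Re z) (- (pi / 2)) x|).

Lemma integrable_wave (f : R -> R) a b th x :
  mu.-integrable `[0, pi] (EFin \o f) -> 0 <= x <= pi ->
  mu.-integrable `[0, x] (EFin \o (fun t => f t * wave a b th t)).
Proof.
move=> If /andP[x0 xpi].
apply: (@integrableS _ _ _ mu `[0, pi]) => //; first exact: subset_itvl.
apply: (@integrable_EFinM_bounded _ _ _ mu _ (measurable_itv _) _ _
  (expR (2 * pi * `|a|)) If); first exact: measurable_wave.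
move=> t; rewrite /= in_itv/= => /andP[t0 tpi].
apply: ler_norm_wave => //; rewrite ger0_norm// (le_trans tpi)//.
by have := @pi_ge0 R; lra.
Qed.

Lemma Rintegral_wave_comb (f g : R -> R) a b th a' b' th' (e : R) x :
  mu.-integrable `[0, pi] (EFin \o f) ->
  mu.-integrable `[0, pi] (EFin \o g) -> 0 <= x <= pi ->
  mu.-integrable `[0, x]
    (EFin \o (fun t => (f t * wave a b th t + e * (g t * wave a' b' th' t)))) /\
  \int[mu]_(t in `[0, x]) (f t * wave a b th t + e * (g t * wave a' b' th' t)) =
  wave_coef f a b th x + e * wave_coef g a' b' th' x.
Proof.
move=> If Ig x0pi.
have Ifw := integrable_wave a b th If x0pi.
have Igw := integrable_wave a' b' th' Ig x0pi.
have Iegw : mu.-integrable `[0, x] (EFin \o (fun t => e * (g t * wave a' b' th' t))).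
  exact: (@integrable_EFinZ _ _ _ mu _ (measurable_itv _) _ e Igw).
split; first exact: (@integrable_EFinD _ _ _ mu _ (measurable_itv _) _ _ Ifw Iegw).
by rewrite RintegralD// RintegralZl.
Qed.

(** Treats sine and cosine together: both kernels have this form with e1 = 1 and e3 = -1, for
    different orders of the four waves. *)
Lemma cint_wave_comb (q K : R -> R[i]) (b a1 th1 a2 th2 a3 th3 a4 th4 e1 e3 x : R) :
  mu.-integrable `[0, pi] (EFin \o (fun t => Re (q t))) ->
  mu.-integrable `[0, pi] (EFin \o (fun t => Im (q t))) ->
  `|e1| <= 1 -> `|e3| <= 1 -> 0 <= x <= pi ->
  (forall t, K t = ((wave a1 b th1 t + e1 * wave a2 b th2 t) / 2)
     +i* ((wave a3 b th3 t + e3 * wave a4 b th4 t) / 2)) ->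
  let f t := Re (q t) in let g t := Im (q t) in
  [/\ mu.-integrable `[0, x] (EFin \o (fun t => Re (q t * K t))),
      mu.-integrable `[0, x] (EFin \o (fun t => Im (q t * K t))) &
      normc (cint x (fun t => q t * K t)) <=
      (`|wave_coef f a1 b th1 x| + `|wave_coef f a2 b th2 x|
       + `|wave_coef f a3 b th3 x| + `|wave_coef f a4 b th4 x|)
      + (`|wave_coef g a1 b th1 x| + `|wave_coef g a2 b th2 x|
       + `|wave_coef g a3 b th3 x| + `|wave_coef g a4 b th4 x|)].
Proof.
move=> If Ig e1le e3le x0pi KE f g.
have itgD (u v : R -> R) : mu.-integrable `[0, x] (EFin \o u) ->
    mu.-integrable `[0, x] (EFin \o v) ->
    mu.-integrable `[0, x] (EFin \o (fun t => u t + v t)).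
  exact: (@integrable_EFinD _ _ _ mu _ (measurable_itv _)).
have itgZ (k : R) (u : R -> R) : mu.-integrable `[0, x] (EFin \o u) ->
    mu.-integrable `[0, x] (EFin \o (fun t => k * u t)).
  exact: (@integrable_EFinZ _ _ _ mu _ (measurable_itv _)).
have [I1 E1] := Rintegral_wave_comb a1 b th1 a2 b th2 e1 If If x0pi.
have [I2 E2] := Rintegral_wave_comb a3 b th3 a4 b th4 e3 Ig Ig x0pi.
have [I3 E3] := Rintegral_wave_comb a3 b th3 a4 b th4 e3 If If x0pi.
have [I4 E4] := Rintegral_wave_comb a1 b th1 a2 b th2 e1 Ig Ig x0pi.
have ReE : (fun t => Re (q t * K t)) = (fun t =>
    2^-1 * (f t * wave a1 b th1 t + e1 * (f t * wave a2 b th2 t))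
    + - 2^-1 * (g t * wave a3 b th3 t + e3 * (g t * wave a4 b th4 t))).
  by apply/funext => t; rewrite ReM KE /f /g /=; ring.
have ImE : (fun t => Im (q t * K t)) = (fun t =>
    2^-1 * (f t * wave a3 b th3 t + e3 * (f t * wave a4 b th4 t))
    + 2^-1 * (g t * wave a1 b th1 t + e1 * (g t * wave a2 b th2 t))).
  by apply/funext => t; rewrite ImM KE /f /g /=; ring.
split.
- by rewrite ReE; apply: itgD; apply: itgZ.
- by rewrite ImE; apply: itgD; apply: itgZ.
apply: le_trans (normc_le _) _; rewrite /cint /= ReE ImE.
rewrite RintegralD//; [|exact: itgZ..].
rewrite RintegralD//; [|exact: itgZ..].
rewrite !RintegralZl// E1 E2 E3 E4 -/f -/g.
have eh (e u v : R) : `|e| <= 1 -> `|u + e * v| <= `|u| + `|v|.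
  move=> e1'; rewrite (le_trans (ler_normD _ _))// lerD2l normrM.
  by rewrite -[leRHS]mul1r ler_wpM2r.
have half (u v : R) : `|2^-1 * u| + `|2^-1 * v| <= (`|u| + `|v|) / 2.
  by rewrite !normrM (ger0_norm (_ : 0 <= 2^-1)) ?invr_ge0// -mulrDr mulrC.
set A1 := wave_coef f a1 b th1 x; set A2 := wave_coef f a2 b th2 x.
set A3 := wave_coef f a3 b th3 x; set A4 := wave_coef f a4 b th4 x.
set B1 := wave_coef g a1 b th1 x; set B2 := wave_coef g a2 b th2 x.
set B3 := wave_coef g a3 b th3 x; set B4 := wave_coef g a4 b th4 x.
have := eh _ A1 A2 e1le; have := eh _ A3 A4 e3le.
have := eh _ B1 B2 e1le; have := eh _ B3 B4 e3le.
rewrite mulNr.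
have := ler_normB (2^-1 * (A1 + e1 * A2)) (2^-1 * (B3 + e3 * B4)).
have := ler_normD (2^-1 * (A3 + e3 * A4)) (2^-1 * (B1 + e1 * B2)).
have := half (A1 + e1 * A2) (B3 + e3 * B4).
have := half (A3 + e3 * A4) (B1 + e1 * B2).
have := (normr_ge0 A1, normr_ge0 A2, normr_ge0 A3, normr_ge0 A4).
have := (normr_ge0 B1, normr_ge0 B2, normr_ge0 B3, normr_ge0 B4).
move=> [[[? ?] ?] ?] [[[? ?] ?] ?]; lra.
Qed.

Lemma cint_csin (q : R -> R[i]) z x :
  mu.-integrable `[0, pi] (EFin \o (fun t => Re (q t))) ->
  mu.-integrable `[0, pi] (EFin \o (fun t => Im (q t))) -> 0 <= x <= pi ->
  let F t := q t * csin (2%:R * z * t%:C) in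
  [/\ mu.-integrable `[0, x] (EFin \o (fun t => Re (F t))),
      mu.-integrable `[0, x] (EFin \o (fun t => Im (F t))) &
      normc (cint x F) <= wave_coefs (fun t => Re (q t)) z x
        + wave_coefs (fun t => Im (q t)) z x].
Proof.
move=> If Ig x0pi; have e1 : `|1| <= 1 :> R by rewrite normr1.
have e2 : `|-1| <= 1 :> R by rewrite normrN normr1.
pose a := 2 * Im z; pose b := 2 * Re z; pose h := - (pi / 2) : R.
have KE t : csin (2%:R * z * t%:C) =
    ((wave (- a) b h t + 1 * wave a b h t) / 2)
    +i* ((wave a b 0 t + -1 * wave (- a) b 0 t) / 2).
  by rewrite csin_waves mul1r mulN1r.
have [I1 I2 le] := cint_wave_comb If Ig e1 e2 x0pi KE.
have sumE (u1 u2 u3 u4 v1 v2 v3 v4 : R) :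
    (u1 + u2 + u3 + u4) + (v1 + v2 + v3 + v4) =
    ((u3 + u2) + (u4 + u1)) + ((v3 + v2) + (v4 + v1)) by ring.
by split => //; rewrite sumE in le.
Qed.

Lemma cint_ccos (q : R -> R[i]) z x :
  mu.-integrable `[0, pi] (EFin \o (fun t => Re (q t))) ->
  mu.-integrable `[0, pi] (EFin \o (fun t => Im (q t))) -> 0 <= x <= pi ->
  let F t := q t * ccos (2%:R * z * t%:C) in
  [/\ mu.-integrable `[0, x] (EFin \o (fun t => Re (F t))),
      mu.-integrable `[0, x] (EFin \o (fun t => Im (F t))) &
      normc (cint x F) <= wave_coefs (fun t => Re (q t)) z x
        + wave_coefs (fun t => Im (q t)) z x].
Proof.
move=> If Ig x0pi; have e1 : `|1| <= 1 :> R by rewrite normr1.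
have e2 : `|-1| <= 1 :> R by rewrite normrN normr1.
pose a := 2 * Im z; pose b := 2 * Re z; pose h := - (pi / 2) : R.
have KE t : ccos (2%:R * z * t%:C) =
    ((wave (- a) b 0 t + 1 * wave a b 0 t) / 2)
    +i* ((wave (- a) b h t + -1 * wave a b h t) / 2).
  by rewrite ccos_waves mul1r mulN1r.
have [I1 I2 le] := cint_wave_comb If Ig e1 e2 x0pi KE.
have sumE (u1 u2 u3 u4 v1 v2 v3 v4 : R) :
    (u1 + u2 + u3 + u4) + (v1 + v2 + v3 + v4) =
    ((u2 + u4) + (u1 + u3)) + ((v2 + v4) + (v1 + v3)) by ring.
by split => //; rewrite sumE in le.
Qed.

End ComplexKernels.

(** * Decay of the functions Upsilon *)

Section Families.
Variable R : realType.
Implicit Types g h : R -> int -> R.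

(* The two notions of decay in n of the theorem, tending to 0 uniformly in x and
   being bounded in l_p uniformly in x, are treated at once. *)
Record family_class (P : (R -> int -> R) -> Prop) : Prop := {
  family0 : P (fun _ _ => 0);
  family_le : forall g h,
    (forall x n, 0 <= x <= pi -> 0 <= g x n <= h x n) -> P h -> P g;
  familyD : forall g h, (forall x n, 0 <= x <= pi -> 0 <= g x n) ->
    (forall x n, 0 <= x <= pi -> 0 <= h x n) ->
    P g -> P h -> P (fun x n => g x n + h x n)
}.

Lemma family_sum P (I : Type) (s : seq I) (g : I -> R -> int -> R) :
  family_class P -> (forall i x n, 0 <= x <= pi -> 0 <= g i x n) ->
  (forall i, P (g i)) -> P (fun x n => \sum_(i <- s) g i x n).
Proof.
move=> FP g0 Pg; elim: s => [|i s ih].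
  by apply: (family_le FP) (family0 FP) => x n _; rewrite big_nil lexx.
apply: (family_le FP) (familyD FP (g0 i) _ (Pg i) ih) => x n xI; last first.
  by apply: sumr_ge0 => j _; exact: g0.
by rewrite big_cons lexx andbT addr_ge0 ?g0// sumr_ge0// => j _; exact: g0.
Qed.

Definition vanishing g : Prop := forall eta : R, 0 < eta ->
  exists N : nat, forall n : int, (N <= `|n|)%N ->
  forall x, 0 <= x <= pi -> g x n <= eta.

Lemma vanishing_class : family_class vanishing.
Proof.
split.
- by move=> eta eta0; exists 0%N => n _ x _; exact: ltW.
- move=> g h gh vh eta /vh[N HN]; exists N => n nN x x0pi.
  by have /andP[_ /le_trans] := gh x n x0pi; apply; exact: HN.
- move=> g h _ _ vg vh eta eta0.
  have [N HN] := vg _ (divr_gt0 eta0 (ltr0n _ 2)).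
  have [N' HN'] := vh _ (divr_gt0 eta0 (ltr0n _ 2)).
  exists (maxn N N') => n; rewrite geq_max => /andP[nN nN'] x x0pi.
  by rewrite (splitr eta) lerD ?HN ?HN'.
Qed.

(** [C] is chosen before x, which later allows integration in x. Duplicate-free lists stand for
    finite sets of indices. *)
Definition power_summable (p : R) g : Prop := exists C : R,
  forall s : seq int, uniq s -> forall x, 0 <= x <= pi ->
  \sum_(n <- s) g x n `^ p <= C.

(** a + b is at most twice the larger term; unlike convexity, this covers every p >= 0. *)
Lemma powRD_le (p a b : R) : 0 <= p -> 0 <= a -> 0 <= b ->
  (a + b) `^ p <= 2 `^ p * (a `^ p + b `^ p).
Proof.
move=> p0 a0 b0.
wlog ab : a b a0 b0 / a <= b.
  move=> H; have [/H|/ltW /H] := leP a b; first exact.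
  by rewrite addrC [b `^ p + _]addrC; exact.
apply: (@le_trans _ _ ((2 * b) `^ p)).
  by rewrite ge0_ler_powR ?nnegrE ?addr_ge0 ?mulr_ge0//; lra.
by rewrite powRM// ler_wpM2l ?powR_ge0// lerDr powR_ge0.
Qed.

Lemma power_summable_class (p : R) : 0 < p -> family_class (power_summable p).
Proof.
move=> p0; split.
- exists 0 => s _ x _; rewrite big1// => n _; rewrite powR0//.
  by rewrite gt_eqF.
- move=> g h gh [C HC]; exists C => s us x x0pi; apply: le_trans (HC s us x x0pi).
  apply: ler_sum => n _; have /andP[g0 le] := gh x n x0pi.
  by rewrite ge0_ler_powR ?nnegrE ?(ltW p0)// (le_trans g0 le).
- move=> g h g0 h0 [C HC] [C' HC']; exists (2 `^ p * (C + C')) => s us x x0pi.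
  apply: (@le_trans _ _ (\sum_(n <- s) 2 `^ p * (g x n `^ p + h x n `^ p))).
    by apply: ler_sum => n _; apply: powRD_le; rewrite ?g0 ?h0// ltW.
  rewrite -mulr_sumr ler_wpM2l ?powR_ge0// big_split lerD//.
  + exact: HC.
  + exact: HC'.
Qed.

End Families.

(** * Integrability of the entries of the potential *)

Section Potential.
Variable R : realType.
Local Notation mu := (@lebesgue_measure R).
Local Notation Re := complex.Re.
Local Notation Im := complex.Im.
Local Notation normc := ComplexField.Normc.normc.

Definition real_Lp (p : R) (f : R -> R) : Prop :=
  measurable_fun `[0, pi] f /\
  mu.-integrable `[0, pi] (EFin \o (fun t => `|f t| `^ p)).

Lemma measurable_normc (A : set R) (f : R -> R[i]) :
  measurable_fun A (fun t => Re (f t)) -> measurable_fun A (fun t => Im (f t)) ->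
  measurable_fun A (fun t => normc (f t)).
Proof.
move=> mr mi; rewrite (_ : (fun t => normc (f t)) =
    Num.sqrt \o (fun t => Re (f t) ^+ 2 + Im (f t) ^+ 2)); last first.
  by apply/funext => t /=; case: (f t).
apply: measurableT_comp.
  by apply: continuous_measurable_fun; exact: sqrt_continuous.
by apply: measurable_funD; exact: measurable_funX.
Qed.

Lemma measurable_norm_powR (A : set R) (f : R -> R) (p : R) :
  measurable_fun A f -> measurable_fun A (fun t => `|f t| `^ p).
Proof.
move=> mf; apply: (measurableT_comp (measurable_powR p)) => //.
exact: measurableT_comp mf.
Qed.

Lemma norm0pi_powR (p : R) (f : R -> R[i]) : p != 0 ->
  (norm0pi p%:E f `^ p)%E = (\int[mu]_(t in `[0%R, pi]) (normc (f t) `^ p)%:E)%E.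
Proof.
move=> p0; rewrite /norm0pi powR_Lnorm// [RHS]integral_mkcond.
apply: eq_integral => t _; rewrite !patchE; case: ifP => _ /=.
  by rewrite ger0_norm// normc_ge0.
by rewrite normr0 powR0.
Qed.

Lemma Lspace0pi_real_Lp (p : R) (f : R -> R[i]) : 0 < p -> Lspace0pi p f ->
  real_Lp p (fun t => Re (f t)) /\ real_Lp p (fun t => Im (f t)).
Proof.
move=> p0 [mr mi fp].
have mn := measurable_normc mr mi.
have In : mu.-integrable `[0, pi] (EFin \o (fun t => normc (f t) `^ p)).
  apply/integrableP; split.
    apply/measurable_EFinP; exact: (measurableT_comp (measurable_powR p)).
  under eq_integral do rewrite /= ger0_norm ?powR_ge0//.
  rewrite -norm0pi_powR ?gt_eqF//; apply: poweR_lty => //.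
have bound (g : R -> R) : measurable_fun `[0, pi] g ->
    (forall t, `|g t| <= normc (f t)) -> real_Lp p g.
  move=> mg gf; split => //.
  apply: (@integrable_EFin_le _ _ _ mu _ (measurable_itv _) _ _
    (measurable_norm_powR p mg) _ In) => t _.
  rewrite !(ger0_norm (powR_ge0 _ _)) ge0_ler_powR ?nnegrE ?(ltW p0)//.
  exact: normc_ge0.
by split; apply: bound => // t; [exact: normc_ge_Re|exact: normc_ge_Im].
Qed.

Lemma real_LpD (p : R) (f g : R -> R) : 0 <= p -> real_Lp p f -> real_Lp p g ->
  real_Lp p (fun t => f t + g t).
Proof.
move=> p0 [mf If] [mg Ig].
have mfg : measurable_fun `[0, pi] (fun t => f t + g t) by exact: measurable_funD.
split => //.
have IfgD := @integrable_EFinD _ _ _ mu _ (measurable_itv _) _ _ If Ig.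
have IfgZ := @integrable_EFinZ _ _ _ mu _ (measurable_itv _) _ (2 `^ p) IfgD.
apply: (@integrable_EFin_le _ _ _ mu _ (measurable_itv _) _ _
  (measurable_norm_powR p mfg) _ IfgZ) => t _.
rewrite [leRHS]ger0_norm ?mulr_ge0 ?addr_ge0 ?powR_ge0//.
rewrite (ger0_norm (powR_ge0 _ _)); apply: le_trans (powRD_le _ _ _) => //.
by rewrite ge0_ler_powR ?nnegrE ?addr_ge0// ler_normD.
Qed.

(** Indices start at 0: j = 0, 1 belong to q_1 and j = 2, 3 to q_2 + q_3. The factor 1/2 of the
    latter stays outside and reappears in [upsilonE]. *)
Definition potential_part (Q : R -> 'M[R[i]]_2) (j : 'I_4) (t : R) : R[i] :=
  if (j < 2)%N then q1 Q t else q2 Q t + q3 Q t.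

Lemma potential_part_Lp (p : R) Q j : 0 < p -> potential_Lp p Q ->
  real_Lp p (fun t => Re (potential_part Q j t)) /\
  real_Lp p (fun t => Im (potential_part Q j t)).
Proof.
move=> p0 QL; rewrite /potential_part; case: (j < 2)%N.
  exact: (Lspace0pi_real_Lp p0 (QL 0 0)).
have [r2 i2] := Lspace0pi_real_Lp p0 (QL 0 1).
have [r3 i3] := Lspace0pi_real_Lp p0 (QL 1 0).
have := real_LpD (ltW p0) r2 r3; have := real_LpD (ltW p0) i2 i3.
rewrite (_ : (fun t => Im (Q t 0 1) + _) = fun t => Im (q2 Q t + q3 Q t)); last first.
  by apply/funext => t; rewrite ImD.
rewrite (_ : (fun t => Re (Q t 0 1) + _) = fun t => Re (q2 Q t + q3 Q t)); last first.
  by apply/funext => t; rewrite ReD.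
by move=> ? ?.
Qed.

Lemma real_Lp_integrable (p : R) f : 1 <= p -> real_Lp p f ->
  mu.-integrable `[0, pi] (EFin \o f).
Proof.
move=> p1 [mf If].
by apply: (@integrable_powR _ _ _ mu _ (measurable_itv _) (mu0pi R) f p).
Qed.

End Potential.

(** * Decay of upsilon_j along a sequence of points, pointwise and in norm *)

Section UpsilonFamilies.
Variable R : realType.
Local Notation mu := (@lebesgue_measure R).
Local Notation Re := complex.Re.
Local Notation Im := complex.Im.
Local Notation normc := ComplexField.Normc.normc.
Variables (Q : R -> 'M[R[i]]_2).
Hypothesis Q_L1 : potential_Lp 1 Q.
Implicit Types (j : 'I_4) (z : R[i]) (lam : int -> R[i]).

Let re j t := Re (potential_part Q j t).
Let im j t := Im (potential_part Q j t).

Lemma integrable_potential_part j :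
  mu.-integrable `[0, pi] (EFin \o re j) /\ mu.-integrable `[0, pi] (EFin \o im j).
Proof.
have [rj ij] := potential_part_Lp j ltr01 Q_L1.
by split; [exact: real_Lp_integrable rj|exact: real_Lp_integrable ij].
Qed.

Definition upsilon_kernel j z : R[i] := if odd j then ccos z else csin z.

Let integrand j z t := potential_part Q j t * upsilon_kernel j (2%:R * z * t%:C%C).

Lemma upsilonE j x z : upsilon Q j x z =
  (if (j < 2)%N then 1 else 2%:R^-1) * cint x (integrand j z).
Proof.
rewrite /upsilon /integrand /potential_part /upsilon_kernel.
by case: j => -[|[|[|[|//]]]] jlt /=; rewrite ?mul1r.
Qed.

Lemma cint_integrand j z x : 0 <= x <= pi ->
  [/\ mu.-integrable `[0, x] (EFin \o (fun t => Re (integrand j z t))),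
      mu.-integrable `[0, x] (EFin \o (fun t => Im (integrand j z t))) &
      normc (cint x (integrand j z)) <= wave_coefs (re j) z x + wave_coefs (im j) z x].
Proof.
move=> x0pi; have [rj ij] := integrable_potential_part j.
by rewrite /integrand /upsilon_kernel; case: odd;
  [exact: cint_ccos|exact: cint_csin].
Qed.

Lemma normc_upsilon j x z : normc (upsilon Q j x z) <= normc (cint x (integrand j z)).
Proof.
rewrite upsilonE; case: ifP => _; first by rewrite mul1r.
rewrite ComplexField.Normc.normcM -[leRHS]mul1r ler_wpM2r ?normc_ge0//.
rewrite ComplexField.Normc.normcV natc /= expr0n addr0 sqrtr_sqr ger0_norm//.
by rewrite invf_le1// ler1n.
Qed.

Lemma measurable_normc_upsilon j z :
  measurable_fun `[0, pi] (fun x => normc (upsilon Q j x z)).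
Proof.
have pi0pi : 0 <= (pi : R) <= pi by rewrite pi_ge0 lexx.
have [I1 I2 _] := cint_integrand j z pi0pi.
rewrite (_ : (fun x => _) = (fun x =>
    normc (if (j < 2)%N then 1 else 2%:R^-1) * normc (cint x (integrand j z)))); last first.
  by apply/funext => x; rewrite upsilonE ComplexField.Normc.normcM.
apply: measurable_funM; first exact: measurable_cst.
(* The integral is continuous in its upper limit, hence measurable. *)
by apply: measurable_normc; apply: subspace_continuous_measurable_fun => //;
  apply: (@parameterized_integral_continuous R 0 pi) => //; exact: pi_ge0.
Qed.

(** Reduces the decay of upsilon_j to that of real wave coefficients. Only |a n| is prescribed,
    since both signs of 2 Im z occur as exponents. *)
Lemma upsilon_family (P : (R -> int -> R) -> Prop) lam j : family_class P ->
  (forall (f : R -> R) (a : int -> R) (th : R),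
    f = re j \/ f = im j ->
    (forall n, `|a n| = `|2 * Im (lam n)|) ->
    P (fun x n => `|wave_coef f (a n) (2 * Re (lam n)) th x|)) ->
  P (fun x n => normc (upsilon Q j x (lam n))).
Proof.
move=> FP HP.
have coefs f : f = re j \/ f = im j -> P (fun x n => wave_coefs f (lam n) x).
  move=> fj; rewrite /wave_coefs.
  have HPn a th : (forall n, `|a n| = `|2 * Im (lam n)|) -> P _ := HP f a th fj.
  apply: (familyD FP); [by move=> *; rewrite addr_ge0..| |].
    by apply: (familyD FP) => [//|//||]; apply: (HPn (fun n => 2 * Im (lam n))).
  by apply: (familyD FP) => [//|//||]; apply: (HPn (fun n => - (2 * Im (lam n)))) => n;
    rewrite normrN.
have c0 (f : R -> R) n x : 0 <= wave_coefs f (lam n) x by rewrite !addr_ge0.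
apply: (family_le FP)
  (familyD FP _ _ (coefs _ (or_introl erefl)) (coefs _ (or_intror erefl))) => //.
move=> x n x0pi; rewrite normc_ge0 (le_trans (normc_upsilon _ _ _))//.
by have [] := cint_integrand j (lam n) x0pi.
Qed.

Lemma Upsilon_family (P : (R -> int -> R) -> Prop) lam : family_class P ->
  (forall j, P (fun x n => normc (upsilon Q j x (lam n)))) ->
  P (fun x n => Upsilon Q x (lam n)).
Proof.
move=> FP HP; rewrite /Upsilon.
apply: (family_sum (index_enum 'I_4) FP
  (g := fun j x n => normc (upsilon Q j x (lam n)))) => //.
by move=> *; exact: normc_ge0.
Qed.

Lemma norm0pi_pinfty_le (f : R -> R[i]) (eta : R) : 0 <= eta ->
  (forall x, 0 <= x <= pi -> normc (f x) <= eta) -> fine (norm0pi +oo f) <= eta.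
Proof.
move=> eta0 H.
have le : (norm0pi +oo f <= eta%:E)%E.
  rewrite /norm0pi unlock; case: ifP => _; last by rewrite lee_fin.
  apply/ess_supP; apply: nearW => x /=; rewrite patchE; case: ifPn => xI /=.
    by rewrite lee_fin ger0_norm ?normc_ge0// H//; move: xI; rewrite inE /= in_itv.
  by rewrite normr0 lee_fin.
have ge : (0 <= norm0pi +oo f)%E by exact: Lnorm_ge0.
by rewrite -lee_fin fineK// ge0_fin_numE// (le_lt_trans le)// ltry.
Qed.

Lemma Upsilon_sup_vanishing lam :
  (forall j, vanishing (fun x n => normc (upsilon Q j x (lam n)))) ->
  vanishing (fun _ n => Upsilon_norm Q +oo (lam n)).
Proof.
move=> HP.
apply: (family_sum (index_enum 'I_4) (vanishing_class R)
  (g := fun j _ n => fine (norm0pi +oo (fun x => upsilon Q j x (lam n))))).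
  by move=> *; rewrite fine_ge0// Lnorm_ge0.
move=> j eta eta0; have [N HN] := HP j eta eta0.
exists N => n nN _ _; apply: norm0pi_pinfty_le; first exact: ltW.
by move=> x x0pi; exact: HN.
Qed.

(** Sum and integral are exchanged: for each j, the p-th powers of the norms add up to at most the
    integral over [0, pi] of the pointwise sums, hence to at most C pi. *)
Lemma Upsilon_norm_summable (p : R) lam : 0 < p ->
  (forall j, power_summable p (fun x n => normc (upsilon Q j x (lam n)))) ->
  power_summable p (fun _ n => Upsilon_norm Q p%:E (lam n)).
Proof.
move=> p0 HP.
apply: (family_sum (index_enum 'I_4) (power_summable_class p0)
  (g := fun j _ n => fine (norm0pi p%:E (fun x => upsilon Q j x (lam n))))).
  by move=> *; rewrite fine_ge0// Lnorm_ge0.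
move=> j; have [C HC] := HP j.
exists (C * pi) => s us _ _.
have mF n : measurable_fun `[0, pi] (fun x => (normc (upsilon Q j x (lam n)) `^ p)%:E).
  apply/measurable_EFinP; apply: (measurableT_comp (measurable_powR p)) => //.
  exact: measurable_normc_upsilon.
rewrite -lee_fin -sumEFin.
apply: (@le_trans _ _ (\sum_(n <- s)
    \int[mu]_(x in `[0%R, pi]) (normc (upsilon Q j x (lam n)) `^ p)%:E)%E).
  apply: lee_sum => n _; rewrite -norm0pi_powR ?gt_eqF//.
  (* An inequality suffices here: [fine] would send an infinite norm to 0. *)
  have := Lnorm_ge0 mu p%:E ((fun t => (normc (upsilon Q j t (lam n)))%:E) \_ `[0, pi]).
  rewrite -/(norm0pi _ _); case: (norm0pi _ _) => [u| |] //= _. 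
  by rewrite gt_eqF// leey.
rewrite -ge0_integral_sum//; last by move=> n x _; rewrite lee_fin powR_ge0.
apply: (@le_trans _ _ (\int[mu]_(x in `[0%R, pi]) (cst C%:E) x)%E).
  apply: ge0_le_integral => //.
  - by move=> x _; rewrite sume_ge0// => n _; rewrite lee_fin powR_ge0.
  - exact: emeasurable_sum.
  - by move=> x /=; rewrite in_itv/= => x0pi; rewrite sumEFin lee_fin; exact: HC.
rewrite integral_cst//= lebesgue_measure_itv/= lte_fin pi_gt0 oppr0 adde0.
by rewrite -EFinM.
Qed.

End UpsilonFamilies.

(** * Location of the unperturbed eigenvalues and choice of points in the discs *)

Section Eigenvalues.
Variable R : realType.
Local Notation Re := complex.Re.
Local Notation Im := complex.Im.
Local Notation normc := ComplexField.Normc.normc.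
Variables (Q : R -> 'M[R[i]]_2).

(** The logarithmic term takes only two values, and the shift 2 (n div 2) differs from n by n mod 2,
    which is 0 or 1. *)
Lemma Re_eig0_near (z0 z1 : R[i]) : exists2 be : R, 0 <= be &
  forall n : int, `|Re (eig0 z0 z1 n) - n%:~R| <= be.
Proof.
pose w z := Re (- (ci R / pi%:C%C) * cln z).
exists (`|w z0| + `|w z1| + 1); first by rewrite !addr_ge0.
move=> n; rewrite /eig0 ReD -/(w _).
have -> : Re ((2 * (n %/ 2)%Z)%:~R : R[i]) = (2 * (n %/ 2)%Z)%:~R.
  by rewrite -(rmorph_int (real_complex R)).
have -> : n%:~R = (2 * (n %/ 2)%Z)%:~R + (n %% 2)%Z%:~R :> R.
  by rewrite -intrD mulrC -divz_eq.
rewrite opprD addrA addrK.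
have m0 : 0 <= (n %% 2)%Z by exact: modz_ge0.
have m2 : (n %% 2)%Z < 2 by exact: ltz_pmod.
have m1 : `|(n %% 2)%Z%:~R| <= 1 :> R.
  rewrite ger0_norm ?ler0z// (_ : 1 = 1%:~R)// ler_int.
  by rewrite -ltzD1.
apply: le_trans (ler_normB _ _) _; apply: lerD => //.
by case: ifP => _; rewrite ?lerDl ?lerDr.
Qed.

Lemma Upsilon_ge0 x z : 0 <= Upsilon Q x z.
Proof. by apply: sumr_ge0 => j _; exact: normc_ge0. Qed.

Lemma Upsilon_norm_ge0 nu z : 0 <= Upsilon_norm Q nu z.
Proof. by apply: sumr_ge0 => j _; rewrite fine_ge0// Lnorm_ge0. Qed.

(* An unbounded set has supremum 0 by convention, so that no bound on the set is
   needed here. *)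
Lemma smax_attained nu (z0 z1 : R[i]) (n : int) (r eps : R) :
  0 <= r -> r <= eps -> 0 <= smax Q nu z0 z1 n r ->
  exists2 z, normc (z - eig0 z0 z1 n) <= eps &
    smax Q nu z0 z1 n r <= 2 * (Upsilon Q pi z + Upsilon_norm Q nu z).
Proof.
(* If the supremum is 0, the centre of the disc serves; otherwise half of the supremum is the margin
   for a nearly maximal point. *)
move=> r0 re; rewrite le_eqVlt => /predU1P[<-|s0].
  exists (eig0 z0 z1 n); first by rewrite subrr ComplexField.Normc.normc0 (le_trans r0).
  by rewrite mulr_ge0// addr_ge0 ?Upsilon_ge0 ?Upsilon_norm_ge0.
have hs : has_sup [set Upsilon Q pi z + Upsilon_norm Q nu z
    | z in [set z : R[i] | normc (z - eig0 z0 z1 n) <= r]].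
  by apply: contrapT => /sup_out s0'; move: s0; rewrite /smax s0' ltxx.
have [y [z /= zr <-] zs] := sup_adherent (divr_gt0 s0 (ltr0n _ 2)) hs.
exists z; first exact: le_trans re.
by move: zs; rewrite -/(smax Q nu z0 z1 n r); lra.
Qed.

(** The equation for r_n shows s_n >= 0, so that [smax_attained] applies. For |n| < N the centre of
    the disc is taken, which makes the sequence total. *)
Lemma nearly_maximal_points A D nu z0 z1 eps alpha yc ys M c N (r : int -> R) :
  admissible Q A D nu z0 z1 eps alpha yc ys M c N r ->
  exists lam : int -> R[i],
    (forall n, normc (lam n - eig0 z0 z1 n) <= eps) /\
    (forall n : int, (N <= `|n|)%N -> 0 <= smax Q nu z0 z1 n (r n)
      <= 2 * (Upsilon Q pi (lam n) + Upsilon_norm Q nu (lam n))).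
Proof.
move=> adm.
suff /choice[lam Hlam] : forall n : int, exists z,
    normc (z - eig0 z0 z1 n) <= eps /\
    ((N <= `|n|)%N -> 0 <= smax Q nu z0 z1 n (r n)
      <= 2 * (Upsilon Q pi z + Upsilon_norm Q nu z)).
  by exists lam; split => n; have [] := Hlam n.
move=> n; have [Nn|nN] := leqP N `|n|; last first.
  exists (eig0 z0 z1 n); split => //.
  by rewrite subrr ComplexField.Normc.normc0 ltW// (adm_eps adm).
have [r0 re sE _] := adm_r adm Nn.
have s0 : 0 <= smax Q nu z0 z1 n (r n).
  rewrite sE divr_ge0 ?(ltW (adm_M adm))// mulr_ge0 ?(ltW (adm_c adm))//.
  exact: exprn_ge0.
have [z zeps zs] := smax_attained r0 re s0.
by exists z; split => // _; rewrite s0.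
Qed.

(** 2 Re (lam n) lies within 2 (be + eps) of 2 n, and the strip bounds the exponents by 2 alpha,
    both independently of n. *)
Lemma disc_wave_family (lam : int -> R[i]) (z0 z1 : R[i]) (eps alpha : R) :
  0 <= eps -> 0 <= alpha ->
  (forall (n : int) z, normc (z - eig0 z0 z1 n) <= eps -> `|Im z| < alpha) ->
  (forall n, normc (lam n - eig0 z0 z1 n) <= eps) ->
  exists2 be : R, 0 <= be & forall a : int -> R,
    (forall n, `|a n| = `|2 * Im (lam n)|) ->
    wave_family (2 * alpha) be a (fun n => 2 * Re (lam n)).
Proof.
move=> eps0 alpha0 strip lamE.
have [be be0 Hbe] := Re_eig0_near z0 z1.
exists (2 * (be + eps)); first by rewrite mulr_ge0// addr_ge0.
move=> a aE; split => n.
  by rewrite aE normrM normr_nat ler_wpM2l// ltW// (strip n).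
rewrite -mulrBr normrM normr_nat ler_wpM2l//.
have := Hbe n; have := le_trans (normc_ge_Re _) (lamE n); rewrite ReD ReN => h1 h2.
rewrite (_ : _ - _ = (Re (lam n) - Re (eig0 z0 z1 n)) + (Re (eig0 z0 z1 n) - n%:~R)).
  by rewrite addrC (le_trans (ler_normD _ _))// lerD.
by rewrite addrA subrK.
Qed.

End Eigenvalues.

(** * From the decay of Upsilon at the points lambda_n to that of s_n *)

Theorem theorem4p5 (R : realType) (Q : R -> 'M[R[i]]_2) (A D : 'M[R[i]]_2)
    (Q_tr : trace_free Q) (AD_reg : regular A D) (Q_L1 : potential_Lp 1 Q) :
  (forall (z0 z1 : R[i]) (eps alpha : R) (yc ys : R[i] -> R -> 'cV[R[i]]_2)
      (M c : R) (N : nat) (r : int -> R),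
    admissible Q A D +oo%E z0 z1 eps alpha yc ys M c N r ->
    (smax Q +oo%E z0 z1 n%:Z (r n%:Z) @[n --> \oo] --> (0 : R)) /\
    (smax Q +oo%E z0 z1 (- n%:Z) (r (- n%:Z)) @[n --> \oo] --> (0 : R))) /\
  (forall p p' : R, 1 < p -> p <= 2%:R -> p^-1 + p'^-1 = 1 ->
    potential_Lp p Q ->
    forall (z0 z1 : R[i]) (eps alpha : R) (yc ys : R[i] -> R -> 'cV[R[i]]_2)
      (M c : R) (N : nat) (r : int -> R),
    admissible Q A D p'%:E z0 z1 eps alpha yc ys M c N r ->
    (\esum_(n in [set n : int | (N <= `|n|)%N])
        (`|smax Q p'%:E z0 z1 n (r n)| `^ p')%:E < +oo)%E).
Proof.
split=> [z0 z1 eps alpha yc ys M c N r adm|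
    p p' p1 p2 pp' Q_Lp z0 z1 eps alpha yc ys M c N r adm].
- have [lam [lamE slam]] := nearly_maximal_points adm.
  have al0 := ltW (adm_alpha adm).
  have [be be0 fam] := disc_wave_family (ltW (adm_eps adm)) al0 (adm_strip adm) lamE.
  have ups j : vanishing (fun x n => ComplexField.Normc.normc (upsilon Q j x (lam n))).
    apply: (upsilon_family Q_L1 (vanishing_class R)) => f a th fE aE eta eta0.
    have [re_int im_int] := integrable_potential_part Q_L1 j.
    have If : (@lebesgue_measure R).-integrable `[0, pi] (EFin \o f).
      by case: fE => ->.
    exact: (riemann_lebesgue_waves (mulr_ge0 (ler0n _ 2) al0) be0 (fun=> th)
      (fam a aE) If eta0).
  have Ups := Upsilon_family (vanishing_class R) ups.
  have Ups_sup := Upsilon_sup_vanishing ups.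
  have small (eta : R) : 0 < eta -> exists N' : nat, forall n : int, (N' <= `|n|)%N ->
      `|smax Q +oo%E z0 z1 n (r n)| <= eta.
    (* s_n is at most twice a sum of two terms, each at most eta / 4. *)
    move=> eta0; have eta4 : 0 < eta / 4 by rewrite divr_gt0.
    have [N1 H1] := Ups _ eta4; have [N2 H2] := Ups_sup _ eta4.
    exists (maxn N (maxn N1 N2)) => n; rewrite !geq_max => /and3P[nN n1 n2].
    have /andP[s0 sle] := slam n nN; rewrite ger0_norm//; apply: le_trans sle _.
    have pI : 0 <= (pi : R) <= pi by rewrite pi_ge0 lexx.
    by have := H1 n n1 _ pI; have := H2 n n2 _ pI; lra.
  split; apply/cvgrPdist_le => eta /small[N' HN']; exists N' => // n /= nN';
    by rewrite sub0r normrN; apply: HN'; rewrite ?abszN absz_nat.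
- have p0 : 0 < p by exact: lt_trans p1.
  have p'0 : 0 < p'.
    rewrite -invr_gt0 -(addKr p^-1 p'^-1) pp' addrC subr_gt0.
    by rewrite invf_lt1.
  have [lam [lamE slam]] := nearly_maximal_points adm.
  have al0 := ltW (adm_alpha adm).
  have [be be0 fam] := disc_wave_family (ltW (adm_eps adm)) al0 (adm_strip adm) lamE.
  have ups j : power_summable p'
      (fun x n => ComplexField.Normc.normc (upsilon Q j x (lam n))).
    apply: (upsilon_family Q_L1 (power_summable_class p'0)) => f a th fE aE.
    have [re_Lp im_Lp] := potential_part_Lp j p0 Q_Lp.
    have [mf If] : real_Lp p f by case: fE => ->.
    pose K := \int[@lebesgue_measure R]_(t in `[0, pi]) (`|f t| `^ p).
    have K0 : 0 <= K by apply: Rintegral_ge0 => t _; exact: powR_ge0.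
    have [C HC] := hausdorff_young_waves (mulr_ge0 (ler0n _ 2) al0) be0 p1 p2 pp' K0.
    exists C => s us x x0pi.
    exact: (HC a _ (fun=> th) (fam a aE) s us f mf If (lexx _) x x0pi).
  have Ups := Upsilon_family (power_summable_class p'0) ups.
  have Ups_norm := Upsilon_norm_summable Q_L1 p'0 ups.
  have pI : 0 <= (pi : R) <= pi by rewrite pi_ge0 lexx.
  (* The factor 2 of the nearly maximal points is written as a sum, so that [familyD] yields it. *)
  have [C HC] : power_summable p' (fun _ n =>
      (Upsilon Q pi (lam n) + Upsilon_norm Q p'%:E (lam n)) +
      (Upsilon Q pi (lam n) + Upsilon_norm Q p'%:E (lam n))).
    (* The value at x = pi is a family constant in x. *)
    have Ups_pi : power_summable p' (fun _ n => Upsilon Q pi (lam n)).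
      by have [C HC] := Ups; exists C => s us _ _; exact: HC.
    have sum2 : power_summable p' (fun _ n =>
        Upsilon Q pi (lam n) + Upsilon_norm Q p'%:E (lam n)).
      apply: (familyD (power_summable_class p'0)) => // *;
        [exact: Upsilon_ge0|exact: Upsilon_norm_ge0].
    by apply: (familyD (power_summable_class p'0)) => // *;
      rewrite addr_ge0 ?Upsilon_ge0 ?Upsilon_norm_ge0.
  apply: (@le_lt_trans _ _ C%:E); last exact: ltry.
  (* The sum over a set of integers is the supremum over its finite subsets, each listed here
     without repetition. *)
  apply: ge_ereal_sup => _ [F [finF FN] <-].
  rewrite fsbig_finite//= sumEFin lee_fin.
  have := HC (finmap.enum_fset (fset_set F)) (finmap.fset_uniq _) pi pI.
  apply: le_trans.
  rewrite [leLHS]big_seq [leRHS]big_seq; apply: ler_sum => n.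
  rewrite in_fset_set// => /set_mem nF.
  have /andP[s0 sle] := slam n (FN n nF).
  rewrite ger0_norm// ge0_ler_powR ?nnegrE ?(ltW p'0)//.
    by rewrite !addr_ge0 ?Upsilon_ge0 ?Upsilon_norm_ge0.
  by apply: le_trans sle _; rewrite mulr_natl mulr2n.
Qed.
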